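(* Let $f:\mathbb{N}\to \mathbb{C}$ be a multiplicative function, and suppose that its generating series $F(z)=\sum_{n\geq 1} f(n)z^n\in \mathbb{C}[[z]]$ is $D$-finite over $\mathbb{C}(z)$. Then either there is an integer $k$ and a periodic multiplicative function $\chi:\mathbb{N}\to \mathbb{C}$ such that $f(n)=n^k \chi(n)$ for all $n\in\mathbb{N}$, or $f(n)$ is eventually zero.
   Context: $\mathbb{N}=\{1,2,3,\ldots\}$. A function $f$ on $\mathbb{N}$ is multiplicative if $f(mn)=f(m)f(n)$ whenever $\gcd(m,n)=1$. A function is periodic if there is $d\in\mathbb{N}$ with $\chi(n+d)=\chi(n)$ for all $n$. A power series $F(z)\in\mathbb{C}[[z]]$ is $D$-finite over $\mathbb{C}(z)$ if it satisfies a linear differential equation $\sum_{i=0}^m Q_i(z)F^{(i)}(z)=0$ with polynomials $Q_i(z)\in\mathbb{C}[z]$ not all zero. *)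

(* Defs.v *)
From mathcomp Require Import all_boot all_order all_algebra.
From mathcomp Require Import reals.
From mathcomp Require Export complex.

Set Implicit Arguments.
Unset Strict Implicit.
Unset Printing Implicit Defensive.

Import GRing.Theory.
Local Open Scope ring_scope.

(* A function on {1, 2, 3, ...} is represented by a function on [nat] whose
   value at 0 is junk: no definition below depends on it. *)

(* [f 1 = 1] is not required, so the zero function is multiplicative. *)
Definition multiplicative_fun (K : nzRingType) (f : nat -> K) : Prop :=
  forall m n : nat, (0 < m)%N -> (0 < n)%N -> coprime m n ->
    f (m * n)%N = f m * f n.

Definition periodic_fun (K : nzRingType) (f : nat -> K) : Prop :=
  exists2 d : nat, (0 < d)%N & forall n : nat, (0 < n)%N -> f (n + d)%N = f n.

Definition eventually_zero (K : nzRingType) (f : nat -> K) : Prop :=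
  exists N : nat, forall n : nat, (N < n)%N -> f n = 0.

(* The formal power series \sum_n a_n z^n is represented by the sequence a. *)
Definition fps (K : nzRingType) : Type := nat -> K.

Definition fps_of_poly (K : nzRingType) (Q : {poly K}) : fps K :=
  fun n => Q`_n.

Definition fps_mul (K : nzRingType) (A B : fps K) : fps K :=
  fun n => \sum_(i < n.+1) A i * B (n - i)%N.

Definition fps_deriv (K : nzRingType) (A : fps K) : fps K :=
  fun n => A n.+1 *+ n.+1.

Definition fps_derivn (K : nzRingType) (i : nat) (A : fps K) : fps K :=
  iter i (@fps_deriv K) A.

Definition D_finite (K : fieldType) (F : fps K) : Prop :=
  exists (m : nat) (Q : 'I_m.+1 -> {poly K}),
    (exists i, Q i != 0) /\
    forall n : nat,
      \sum_(i < m.+1) fps_mul (fps_of_poly (Q i)) (fps_derivn i F) n = 0.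

(* \sum_(n >= 1) f(n) z^n *)
Definition gen_series (K : nzRingType) (f : nat -> K) : fps K :=
  fun n => if n == 0%N then 0 else f n.

(* Main.v *)
Require Import Defs.
From mathcomp Require Import all_boot all_order all_algebra.
From mathcomp Require Import reals complex.
From mathcomp Require Import cyclic boolp zify ring.

(** The recurrence for f is used over C(x), on a residue class c mod M chosen so
    that the dimension r of the C(x)-span of the shifts x |-> f(x + j) is as
    small as possible; a relation valid on a subclass is then valid on the
    class.  If q = 1 mod M is a power of a large prime with f(q) <> 0, then
    multiplying by f(q) turns a relation sum_k u_k(x) f(x + k) = 0 into
    sum_k u_k(x/q) f(x + q k) = 0: first for the x divisible by q, then
    on the whole class.  Iterating, f(x + k) is a combination of r fixed shifts
    with coefficients of height O(log k).  A singularity of the recurrence that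
    is not apparent would create linearly many poles, so all poles of these
    coefficients stay near 0 or near -k.  After multiplying f by a polynomial
    pr, the N functions (pr f)(x + M t), t < N, lie in a space of dimension
    O(log N) over C and so are dependent: pr f satisfies a recurrence with
    constant coefficients on the class.  Its characteristic roots are
    roots of unity, since transferring an eigenvector yields geometric sequences
    with r + 1 ratios in a space of dimension r.  Hence f agrees
    with a rational function on each class modulo some N.  On 1 mod N that
    function R satisfies R(x y) = R(x) R(y), so it is c x^k, and comparing f at
    n and at n y, for y = 1 mod N prime to n, shows that f(n) / n^k only depends
    on n mod N. *)

Set Implicit Arguments.
Unset Strict Implicit.
Unset Printing Implicit Defensive.
Import Order.TTheory GRing.Theory Num.Theory.
Local Open Scope ring_scope.

(** * Properties of large integers in a residue class *)

(** Sequences are compared only as germs at infinity along a progression, so that a nonzero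
    polynomial factor, having finitely many integer zeros, can be cancelled. *)
Definition ev_mod (c M : nat) (P : nat -> Prop) : Prop :=
  exists n0, forall x, (n0 <= x)%N -> x = c %[mod M] -> P x.

Lemma ev_and c M P Q : ev_mod c M P -> ev_mod c M Q -> ev_mod c M (fun x => P x /\ Q x).
Proof.
move=> [n1 h1] [n2 h2]; exists (maxn n1 n2) => x; rewrite geq_max.
by move=> /andP[l1 l2] hx; split; [apply: h1 | apply: h2].
Qed.

Lemma ev_imp c M (P Q : nat -> Prop) : (forall x, P x -> Q x) -> ev_mod c M P -> ev_mod c M Q.
Proof. by move=> PQ [n0 h]; exists n0 => x lx hx; apply/PQ/h. Qed.

Lemma ev_all c M (I : finType) (P : I -> nat -> Prop) :
  (forall i, ev_mod c M (P i)) -> ev_mod c M (fun x => forall i, P i x).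
Proof.
move=> /choice[n0 h]; exists (\max_i n0 i) => x lx hx i.
by apply: h => //; apply: leq_trans lx; apply: leq_bigmax.
Qed.

Lemma ev_sub c M c' M' P :
  (M %| M')%N -> c' = c %[mod M] -> ev_mod c M P -> ev_mod c' M' P.
Proof.
move=> dM ec [n0 h]; exists n0 => x lx hx; apply: h => //.
by rewrite -ec -(modn_dvdm x dM) hx modn_dvdm.
Qed.

Lemma ev_shift c M k P : (M %| k)%N -> ev_mod c M P -> ev_mod c M (fun x => P (x + k)%N).
Proof.
move=> dk [n0 h]; exists n0 => x lx hx; apply: h.
  by rewrite (leq_trans lx) // leq_addr.
by rewrite -modnDmr (eqP dk) addn0.
Qed.

Lemma ev_unshift c M k P : (M %| k)%N -> ev_mod c M (fun x => P (x + k)%N) -> ev_mod c M P.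
Proof.
move=> dk [n0 h]; exists (n0 + k)%N => x lx hx.
have lkx : (k <= x)%N by lia.
rewrite -(subnK lkx); apply: h; first by lia.
by rewrite -hx -[in RHS](subnK lkx) -[RHS]modnDmr (eqP dk) addn0.
Qed.

Lemma ev_true c M (P : nat -> Prop) : (forall x, P x) -> ev_mod c M P.
Proof. by move=> h; exists 0%N => x _ _. Qed.

(** * Polynomials at large integers, shifts and dilations *)

Section Poly.
Variable K : numClosedFieldType.
Implicit Types (p u D : {poly K}) (v : nat -> K).

Lemma natf_inj (m n : nat) : m%:R = n%:R :> K -> m = n.
Proof. by move/eqP; rewrite eqr_nat => /eqP. Qed.

Lemma poly_ev0 c M p : (0 < M)%N -> ev_mod c M (fun x => p.[x%:R] = 0) -> p = 0.
Proof.
move=> M0 [n0 h]; apply/eqP; apply: contraT => p0.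
pose rs := [seq ((n0 + i) * M + c)%:R | i <- iota 0 (size p)] : seq K.
suff: (size rs < size p)%N by rewrite size_map size_iota ltnn.
apply: max_poly_roots => //.
  apply/allP => _ /mapP[i _ ->]; apply/eqP/h; first by nia.
  by rewrite modnMDl.
rewrite map_inj_uniq ?iota_uniq // => i j /natf_inj; nia.
Qed.

Lemma poly_ev_neq0 c M p : p != 0 -> ev_mod c M (fun x => p.[x%:R] != 0).
Proof.
move=> p0; have [rs e] := closed_field_poly_normal p.
have hB z : exists B : nat, forall n, (B <= n)%N -> n%:R != z :> K.
  have [[m hm]|h] := EM (exists m : nat, m%:R = z).
    by exists m.+1 => n ln; apply/eqP => en; move: ln; rewrite -hm in en; move/natf_inj: en => ->; rewrite ltnn.
  by exists 0%N => n _; apply/eqP => en; apply: h; exists n.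
have /= {hB}/choice[B hB] := hB.
exists (\max_(z <- rs) B z) => x lx _.
rewrite -/(root p x%:R) e rootE hornerZ mulf_neq0 ?lead_coef_eq0 //.
rewrite horner_prod prodf_seq_neq0; apply/allP => z zr /=.
rewrite !hornerE subr_eq0; apply: hB; apply: leq_trans lx.
exact: (leq_bigmax_seq z).
Qed.

Definition shiftp k p := p \Po ('X + (k%:R)%:P).
Definition dilp q p := p \Po ((q%:R^-1) *: 'X).

Lemma shiftp_eval k p (z : K) : (shiftp k p).[z] = p.[z + k%:R].
Proof. by rewrite /shiftp horner_comp !hornerE. Qed.

Lemma shiftp_evaln k p (x : nat) : (shiftp k p).[x%:R] = p.[(x + k)%:R].
Proof. by rewrite shiftp_eval natrD. Qed.

Lemma dilp_eval q p (z : K) : (dilp q p).[z] = p.[z / q%:R].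
Proof. by rewrite /dilp horner_comp !hornerE mulrC. Qed.

Lemma dilp_evaln q p (y : nat) : (0 < q)%N -> (dilp q p).[(q * y)%:R] = p.[y%:R].
Proof.
by move=> q0; rewrite dilp_eval natrM mulrAC divff ?mul1r // pnatr_eq0 -lt0n.
Qed.

Lemma size_shiftp k p : size (shiftp k p) = size p.
Proof. by rewrite size_comp_poly2 // size_XaddC. Qed.

Lemma size_dilp q p : (0 < q)%N -> size (dilp q p) = size p.
Proof.
move=> q0; rewrite size_comp_poly2 // size_scale ?size_polyX //.
by rewrite invr_eq0 pnatr_eq0 -lt0n.
Qed.

Lemma shiftp_eq0 k p : (shiftp k p == 0) = (p == 0).
Proof. by rewrite -!size_poly_eq0 size_shiftp. Qed.

Lemma dilp_eq0 q p : (0 < q)%N -> (dilp q p == 0) = (p == 0).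
Proof. by move=> q0; rewrite -!size_poly_eq0 size_dilp. Qed.

(* Linear dependence by counting unknowns: the unknowns are the c i, the
   equations the coefficients of the w i j. *)
Lemma poly_dep (I : finType) (r S : nat) (w : I -> 'I_r -> {poly K}) :
  (r * S < #|I|)%N -> (forall i j, (size (w i j) <= S)%N) ->
  exists2 c : I -> K, (exists i, c i != 0) &
    forall j, \sum_i c i *: w i j = 0.
Proof.
move=> lt hS.
pose T : finType := ('I_r * 'I_S)%type.
pose A : 'M[K]_(#|I|, #|T|) :=
  \matrix_(a, b) let: (j, k) := enum_val b : 'I_r * 'I_S in (w (enum_val a) j)`_k.
have kA : kermx A != 0.
  rewrite kermx_eq0 /row_free neq_ltn; apply/orP; left.
  apply: leq_ltn_trans (rank_leq_col _) _.
  by rewrite card_prod !card_ord.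
have /rowV0Pn[v vA v0] := kA.
have vA0 : v *m A = 0.
  by have /submxP[D ->] := vA; rewrite -mulmxA mulmx_ker mulmx0.
exists (fun i => v 0 (enum_rank i)).
  have /rV0Pn[a ha] := v0.
  by exists (enum_val a); rewrite enum_valK.
move=> j; apply/polyP => b; rewrite coef0 coef_sum.
have [lb|gb] := ltnP b S; last first.
  apply: big1 => i _; rewrite coefZ nth_default ?mulr0 //.
  exact: leq_trans (hS _ _) gb.
have /matrixP/(_ 0 (enum_rank (j, Ordinal lb))) := vA0.
rewrite !mxE => vj; rewrite -[RHS]vj (reindex (@enum_val I I)) /=; last first.
  by exists enum_rank => ? _; rewrite ?enum_valK ?enum_rankK.
by apply: eq_bigr => a _; rewrite coefZ !mxE enum_valK enum_rankK.
Qed.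

End Poly.

(** * Spans of the shifts of a sequence *)

Section Generators.
Variables (K : numClosedFieldType) (f : nat -> K).
Implicit Types (D : {poly K}) (v : nat -> K) (phi : seq ({poly K} * nat)).

(** Relations are kept as lists of pairs (coefficient, shift), so that dilation can act on the data
    and not only on the values. *)
Definition lform (phi : seq ({poly K} * nat)) (x : nat) : K :=
  \sum_(p <- phi) p.1.[x%:R] * f (x + p.2)%N.

Lemma lform_cons p phi x : lform (p :: phi) x = p.1.[x%:R] * f (x + p.2)%N + lform phi x.
Proof. by rewrite /lform big_cons. Qed.

Lemma lform_cat phi psi x : lform (phi ++ psi) x = lform phi x + lform psi x.
Proof. by rewrite /lform big_cat. Qed.

(** Two localisations are used: [nonzero] gives the rational functions, [nonzero_at z] the local
    ring at z, where poles are detected. *)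
Definition multiplicative_set (S : {poly K} -> bool) : Prop :=
  S 1 /\ forall p p', S p -> S p' -> S (p * p').

Definition nonzero (p : {poly K}) := p != 0.
Definition nonzero_at (z : K) (p : {poly K}) := p.[z] != 0.

Lemma nonzeroM : multiplicative_set nonzero.
Proof. by split; [exact: oner_neq0 | exact: mulf_neq0]. Qed.

Lemma nonzero_atM z : multiplicative_set (nonzero_at z).
Proof.
by split=> [|p p']; rewrite /nonzero_at ?hornerM ?hornerE ?oner_neq0 //; exact: mulf_neq0.
Qed.

(* [v] lies in the span of the shifts [f (x + J i)], as germs on a residue class,
   over the localisation of the polynomial ring at [S]. *)
Definition spanned (S : {poly K} -> bool) c M r (J : 'I_r -> nat) v : Prop :=
  exists2 D : {poly K}, S D & exists u : 'I_r -> {poly K},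
    ev_mod c M (fun x => D.[x%:R] * v x = \sum_i (u i).[x%:R] * f (x + J i)%N).

Section Spanned.
Variables (S : {poly K} -> bool) (SM : multiplicative_set S).
Variables (c M r : nat) (J : 'I_r -> nat).

Lemma spanned_ext v v' : ev_mod c M (fun x => v x = v' x) -> spanned S c M J v -> spanned S c M J v'.
Proof.
move=> e [D D0 [u h]]; exists D => //; exists u.
by apply: ev_imp (ev_and e h) => x [<-].
Qed.

Lemma spanned0 : spanned S c M J (fun=> 0).
Proof.
exists 1; first exact: SM.1.
exists (fun=> 0); apply: ev_true => x; rewrite mulr0 big1 // => i _.
by rewrite hornerE mul0r.
Qed.

Lemma spanned_add v v' : spanned S c M J v -> spanned S c M J v' ->
  spanned S c M J (fun x => v x + v' x).
Proof.
move=> [D D0 [u h]] [D' D0' [u' h']]; exists (D * D'); first exact: SM.2.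
exists (fun i => D' * u i + D * u' i).
apply: ev_imp (ev_and h h') => x [e e']; rewrite hornerM.
transitivity (D'.[x%:R] * (D.[x%:R] * v x) + D.[x%:R] * (D'.[x%:R] * v' x)); first by ring.
rewrite e e' !mulr_sumr -big_split; apply: eq_bigr => i _ /=.
by rewrite hornerD !hornerM mulrDl !mulrA.
Qed.

Lemma spanned_mul (p : {poly K}) v : spanned S c M J v -> spanned S c M J (fun x => p.[x%:R] * v x).
Proof.
move=> [D D0 [u h]]; exists D => //; exists (fun i => p * u i).
apply: ev_imp h => x e; rewrite mulrCA e mulr_sumr.
by apply: eq_bigr => i _; rewrite hornerM mulrA.
Qed.

Lemma spanned_div (p : {poly K}) v : S p -> spanned S c M J (fun x => p.[x%:R] * v x) -> spanned S c M J v.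
Proof.
move=> Sp [D D0 [u h]]; exists (D * p); first exact: SM.2.
by exists u; apply: ev_imp h => x e; rewrite hornerM -mulrA.
Qed.

Lemma spanned_sum (I : eqType) (s : seq I) (F : I -> nat -> K) :
  (forall i, i \in s -> spanned S c M J (F i)) ->
  spanned S c M J (fun x => \sum_(i <- s) F i x).
Proof.
elim: s => [|i s IH] h.
  by apply: spanned_ext spanned0; apply: ev_true => x; rewrite big_nil.
apply: (@spanned_ext (fun x => F i x + \sum_(j <- s) F j x)).
  by apply: ev_true => x; rewrite big_cons.
apply: spanned_add; first by apply/h/mem_head.
by apply: IH => j js; apply: h; rewrite inE js orbT.
Qed.

Lemma spanned_lform phi : (forall p, p \in phi -> spanned S c M J (fun x => f (x + p.2)%N)) ->
  spanned S c M J (lform phi).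
Proof. by move=> h; apply: spanned_sum => p /h; exact: spanned_mul. Qed.

Lemma spanned_base i : spanned S c M J (fun x => f (x + J i)%N).
Proof.
exists 1; first exact: SM.1.
exists (fun j => (j == i)%:R); apply: ev_true => x.
rewrite (bigD1 i) //= eqxx big1 ?addr0 ?hornerE // => j /negbTE ->.
by rewrite hornerE mul0r.
Qed.

Lemma spanned_trans_mul r' (J' : 'I_r' -> nat) (p : {poly K}) v :
  (forall i, spanned S c M J (fun x => p.[x%:R] * f (x + J' i)%N)) ->
  spanned S c M J' v -> spanned S c M J (fun x => p.[x%:R] * v x).
Proof.
move=> h [D SD [u E]]; apply: (spanned_div SD).
apply: (@spanned_ext (fun x => \sum_i (u i).[x%:R] * (p.[x%:R] * f (x + J' i)%N))).
  apply: ev_imp E => x E; rewrite mulrCA E mulr_sumr.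
  by apply: eq_bigr => i _; rewrite mulrCA.
by apply: spanned_sum => i _; exact: spanned_mul.
Qed.

Lemma spanned_trans r' (J' : 'I_r' -> nat) v :
  (forall i, spanned S c M J (fun x => f (x + J' i)%N)) ->
  spanned S c M J' v -> spanned S c M J v.
Proof.
move=> h hv; apply: (spanned_div SM.1); apply: spanned_trans_mul hv => i.
exact: spanned_mul.
Qed.

End Spanned.

Definition gen c M r (J : 'I_r -> nat) :=
  forall k, spanned nonzero c M J (fun x => f (x + k)%N).

(** Independence is required on every subprogression of the class; this is what lets [lform_extend]
    propagate a relation from a subclass to the class. *)
Definition indep c M r (J : 'I_r -> nat) :=
  forall c' M' (u : 'I_r -> {poly K}),
    (0 < M')%N -> (M %| M')%N -> c' = c %[mod M] ->
    ev_mod c' M' (fun x => \sum_i (u i).[x%:R] * f (x + J i)%N = 0) ->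
    forall i, u i = 0.

Lemma gen_sub c M r (J : 'I_r -> nat) c' M' :
  (M %| M')%N -> c' = c %[mod M] -> gen c M J -> gen c' M' J.
Proof.
move=> dM ec g k; have [D D0 [u h]] := g k; exists D => //; exists u.
exact: ev_sub h.
Qed.

Lemma gen_remove c M r (J : 'I_r.+1 -> nat) (u : 'I_r.+1 -> {poly K}) i :
  gen c M J -> u i != 0 ->
  ev_mod c M (fun x => \sum_i (u i).[x%:R] * f (x + J i)%N = 0) ->
  gen c M (fun j => J (lift i j)).
Proof.
move=> g ui h; set J' := fun j => J (lift i j).
have gi : spanned nonzero c M J' (fun x => f (x + J i)%N).
  exists (u i) => //; exists (fun j => - u (lift i j)).
  apply: ev_imp h => x; rewrite (bigD1_ord i) //= => /eqP.
  rewrite addr_eq0 => /eqP ->; rewrite -sumrN; apply: eq_bigr => j _.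
  by rewrite hornerN mulNr.
have gj j : spanned nonzero c M J' (fun x => f (x + J j)%N).
  case: (unliftP i j) => [j' ->|-> //]; exact: (spanned_base nonzeroM c M J' j').
by move=> k; exact: (spanned_trans nonzeroM gj (g k)).
Qed.

(** A dependence on some subclass removes a generator there, and r can drop only finitely often. *)
Lemma gen_indep c M r (J : 'I_r -> nat) : (0 < M)%N -> gen c M J ->
  exists c' M' r' (J' : 'I_r' -> nat), [/\ (0 < M')%N, gen c' M' J' & indep c' M' J'].
Proof.
elim: r c M J => [|r IH] c M J M0 g.
  by exists c, M, 0%N, J; split => // c' M' u _ _ _ _ [].
have [?|nind] := EM (indep c M J); first by exists c, M, r.+1, J.
have [c' [M' [u [M0' [dM [ec [h [i ui]]]]]]]] : exists c' M' (u : 'I_r.+1 -> {poly K}),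
    (0 < M')%N /\ (M %| M')%N /\ c' = c %[mod M] /\
    ev_mod c' M' (fun x => \sum_i (u i).[x%:R] * f (x + J i)%N = 0) /\
    exists i, u i != 0.
  apply: contrapT => no; apply: nind => c' M' u M0' dM ec h i.
  apply/eqP; apply: contraT => ui; case: no.
  by exists c', M', u; do !split => //; exists i.
apply: (IH c' M' _ M0' (gen_remove (gen_sub dM ec g) ui h)).
Qed.

(** Over the rational functions the recurrence can be solved for its top term, so every later shift
    reduces to the first R ones. *)
Lemma gen_recurrence (R : nat) (P : nat -> {poly K}) n0 : P R != 0 ->
  (forall x, (n0 <= x)%N -> \sum_(i < R.+1) (P i).[x%:R] * f (x + i)%N = 0) ->
  gen 0 1 (fun i : 'I_R => i : nat).
Proof.
move=> PR h k; elim/ltn_ind: k => k IH.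
have [lk|gk] := ltnP k R; first exact: (spanned_base nonzeroM 0 1 (fun i : 'I_R => i : nat) (Ordinal lk)).
pose k' := (k - R)%N.
apply: (@spanned_div _ nonzeroM _ _ _ _ (shiftp k' (P R))); first by rewrite /nonzero shiftp_eq0.
apply: (@spanned_ext _ _ _ _ _ (lform [seq (- shiftp k' (P i), k' + i)%N | i : 'I_R <- index_enum 'I_R])).
  exists n0 => x lx _; rewrite /lform big_map /=.
  have := h (x + k')%N; rewrite (leq_trans lx) ?leq_addr // => /(_ isT).
  rewrite big_ord_recr /= addrC => /eqP; rewrite addr_eq0 => /eqP e.
  rewrite shiftp_evaln; rewrite -addnA (subnK gk) in e; rewrite e -sumrN.
  by apply: eq_bigr => i _; rewrite hornerN shiftp_evaln mulNr addnA.
apply: (spanned_lform nonzeroM) => _ /mapP[i _ ->] /=; apply: IH.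
by rewrite -[X in (_ < X)%N](subnK gk) ltn_add2l.
Qed.

End Generators.
Arguments nonzero {K}.
Arguments nonzeroM {K}.

(** * Transfer of relations along multiplication by a prime power *)

Section Vanishing.
Variables (K : numClosedFieldType) (f : nat -> K).
Hypothesis f_mult : multiplicative_fun f.

(** If x = y mod y^2 with y = l^e, then x = y (w y + 1) with coprime factors, so f(x) = 0. Chinese
    remaindering, with a new prime l > Y at each step, puts k consecutive integers in this
    position. *)
Lemma vanishing_window (e B k : nat) : (0 < e)%N ->
  (forall l, prime l -> (B < l)%N -> f (l ^ e)%N = 0) ->
  exists Y m, (0 < Y)%N /\ forall t i, (i < k)%N -> f (m + i + Y * t)%N = 0.
Proof.
move=> e0 h0; elim: k => [|k [Y [m [Y0 hY]]]]; first by exists 1%N, 0%N; split.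
have [l lB pl] := prime_above (maxn B Y); move: lB; rewrite gtn_max => /andP[lB lY].
set y := (l ^ e)%N.
have l_gt1 := prime_gt1 pl.
have y_gt1 : (1 < y)%N by rewrite -(exp1n e) ltn_exp2r.
have coY : coprime Y (y ^ 2).
  rewrite coprimeXr // coprimeXr // coprime_sym prime_coprime //.
  by apply/negP => /dvdn_leq; lia.
(* The term [k * (y ^ 2 - 1)] stands for -k modulo y^2 and makes [m0 + k] congruent to y. The
   multiple of Y in [m'] ensures m <= m', so that m' = m + Y s with s natural. *)
pose m0 := chinese Y (y ^ 2) m (y + k * (y ^ 2 - 1)).
pose m' := (m0 + Y * y ^ 2 * m)%N.
exists (Y * y ^ 2)%N, m'; split; first by rewrite muln_gt0 Y0 expn_gt0; lia.
have em1 : m0 = m %[mod Y] by exact: chinese_modl.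
have em2 : m0 = (y + k * (y ^ 2 - 1))%N %[mod y ^ 2] by exact: chinese_modr.
move=> t i; rewrite ltnS leq_eqVlt => /orP[/eqP ->|ik].
  set x := (m' + k + _)%N.
  have ex : (x %% y ^ 2)%N = y.
    rewrite -[RHS](@modn_small _ (y ^ 2)); last by rewrite -[X in (X < _)%N]expn1 ltn_exp2l.
    have -> : x = ((Y * m + Y * t) * y ^ 2 + (m0 + k))%N.
      by rewrite /x /m'; lia.
    rewrite modnMDl -modnDml em2 modnDml.
    have -> : (y + k * (y ^ 2 - 1) + k = k * y ^ 2 + y)%N.
      have y2 : (0 < y ^ 2)%N by rewrite expn_gt0 (ltnW y_gt1).
      by rewrite -addnA -mulnSr subn1 prednK // addnC.
    by rewrite modnMDl.
  rewrite (divn_eq x (y ^ 2)) ex; move: (x %/ _)%N => {x ex} x.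
  have -> : (x * y ^ 2 + y = y * (x * y + 1))%N.
    by rewrite mulnDr muln1 expnS expn1 mulnCA.
  rewrite f_mult ?h0 ?mul0r ?addn1 //; first exact: ltnW.
  by rewrite -addn1 /coprime gcdnMDl gcdn1.
have [s ->] : exists s, m' = (m + Y * s)%N.
  have lm : (m <= m')%N.
    by rewrite (leq_trans _ (leq_addl _ _)) // leq_pmull // muln_gt0 Y0 expn_gt0 (ltnW y_gt1).
  have /eqP : m' = m %[mod Y] by rewrite /m' addnC -mulnA mulnC modnMDl.
  rewrite eqn_mod_dvd // => /dvdnP[s es]; by exists s; rewrite mulnC -es subnKC.
have -> : (m + Y * s + i + Y * y ^ 2 * t = m + i + Y * (s + y ^ 2 * t))%N by lia.
exact: hY.
Qed.

(** R consecutive zeros of f beyond the integer zeros of [P R] propagate upwards through the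
    recurrence. *)
Lemma window_eventually_zero (R : nat) (P : nat -> {poly K}) n0 Y m : P R != 0 ->
  (forall x, (n0 <= x)%N -> \sum_(i < R.+1) (P i).[x%:R] * f (x + i)%N = 0) ->
  (0 < Y)%N -> (forall t i, (i < R)%N -> f (m + i + Y * t)%N = 0) ->
  eventually_zero f.
Proof.
move=> PR h Y0 hY; have [n1 h1] := poly_ev_neq0 0 1 PR.
pose N := (m + Y * (n0 + n1))%N.
have hN : forall k, f (N + k)%N = 0.
  elim/ltn_ind => k IH; have [lk|gk] := ltnP k R.
    by rewrite /N addnAC; apply: hY.
  have lN : (maxn n0 n1 <= N + (k - R))%N by rewrite /N; nia.
  have := h (N + (k - R))%N; rewrite (leq_trans _ lN) ?leq_maxl // => /(_ isT).
  rewrite big_ord_recr /= big1 => [|i _].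
    rewrite add0r -addnA subnK // => /eqP; rewrite mulf_eq0 => /orP[|/eqP //].
    by rewrite (negbTE (h1 _ _ _)) // ?modn1 // (leq_trans _ lN) ?leq_maxr.
  rewrite -addnA IH ?mulr0 //; have := ltn_ord i; lia.
by exists N => n ln; rewrite -(subnKC (ltnW ln)).
Qed.

(** The exponent e is left free in order to be the totient of M later, which makes l^e = 1 mod M. *)
Lemma exists_prime_power_neq0 (R : nat) (P : nat -> {poly K}) n0 : P R != 0 ->
  (forall x, (n0 <= x)%N -> \sum_(i < R.+1) (P i).[x%:R] * f (x + i)%N = 0) ->
  ~ eventually_zero f ->
  forall e B, (0 < e)%N -> exists l, [/\ prime l, (B < l)%N & f (l ^ e)%N != 0].
Proof.
move=> PR h nz e B e0; apply: contrapT => no; apply: nz.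
have h0 l : prime l -> (B < l)%N -> f (l ^ e)%N = 0.
  by move=> pl lB; apply/eqP; apply: contraT => fl; case: no; exists l.
have [Y [m [Y0 hY]]] := vanishing_window R e0 h0.
exact: (window_eventually_zero PR h Y0 hY).
Qed.

End Vanishing.

(** * Relations under dilation by q *)

Section Transfer.
Variables (K : numClosedFieldType) (f : nat -> K).
Hypothesis f_mult : multiplicative_fun f.
Variables (c M r : nat) (J : 'I_r -> nat).
Hypotheses (M_gt0 : (0 < M)%N) (genJ : gen f c M J) (indJ : indep f c M J).

(** The coordinates of the form in the basis [J] give a relation on the subclass, hence are zero by
    [indJ]; the form itself is then zero on the class. *)
Lemma lform_extend phi c' M' : (0 < M')%N -> (M %| M')%N -> c' = c %[mod M] ->
  ev_mod c' M' (fun x => lform f phi x = 0) -> ev_mod c M (fun x => lform f phi x = 0).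
Proof.
move=> M0' dM ec h.
have [D D0 [u e]] : spanned f nonzero c M J (lform f phi) by apply: (spanned_lform nonzeroM) => p _; exact: genJ.
have u0 : forall i, u i = 0.
  apply: (indJ M0' dM ec); apply: ev_imp (ev_and h (ev_sub dM ec e)) => x [-> <-].
  by rewrite mulr0.
apply: ev_imp (ev_and e (poly_ev_neq0 c M D0)) => x [ex Dx].
apply/eqP; move: ex; rewrite big1 => [/eqP|i _].
  by rewrite mulf_eq0 (negbTE Dx).
by rewrite u0 hornerE mul0r.
Qed.

Variables (l e : nat).
Let q := (l ^ e)%N.
Hypotheses (l_prime : prime l) (e_gt0 : (0 < e)%N) (Ml : coprime M l).
Hypotheses (q1 : q = 1 %[mod M]) (fq : f q != 0).

Lemma q_gt0 : (0 < q)%N. Proof. by rewrite expn_gt0 prime_gt0. Qed.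

Definition dilate_form (phi : seq ({poly K} * nat)) :=
  [seq (dilp q p.1, (q * p.2)%N) | p <- phi].

Lemma lform_dilate phi y : (0 < y)%N -> (forall p, p \in phi -> ~~ (l %| y + p.2)%N) ->
  lform f (dilate_form phi) (q * y)%N = f q * lform f phi y.
Proof.
move=> y0 h; rewrite /lform /dilate_form big_map mulr_sumr; apply: eq_big_seq => p hp /=.
rewrite dilp_evaln ?q_gt0 // -mulnDr f_mult ?q_gt0 //; first by rewrite mulrCA.
  lia.
by rewrite coprimeXl // prime_coprime // h.
Qed.

(** For y = b mod l every argument y + k in the form is prime to l, so that f (q (y + k)) = f q * f
    (y + k). *)
Definition good_shifts (phi : seq ({poly K} * nat)) :=
  exists b, forall p, p \in phi -> ~~ (l %| b + p.2)%N.

Section Class.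
Variable b : nat.
Let y0 := chinese M l c b.

Lemma class_good (phi : seq ({poly K} * nat)) y : (forall p, p \in phi -> ~~ (l %| b + p.2)%N) ->
  y = y0 %[mod M * l] -> forall p, p \in phi -> ~~ (l %| y + p.2)%N.
Proof.
move=> hb ey p /hb; rewrite /dvdn -modnDml -[in X in _ -> X]modnDml.
have -> // : y = b %[mod l].
rewrite -(chinese_modr Ml c b) -/y0.
by rewrite -(modn_dvdm y (dvdn_mull M (dvdnn l))) ey modn_dvdm ?dvdn_mull.
Qed.

Lemma class_c : y0 = c %[mod M]. Proof. exact: chinese_modl. Qed.

Lemma class_qc : (q * y0)%N = c %[mod M].
Proof. by rewrite -modnMml q1 modnMml mul1n class_c. Qed.

Lemma class_qy x : x = (q * y0)%N %[mod q * (M * l)] ->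
  exists2 y, x = (q * y)%N & y = y0 %[mod M * l].
Proof.
move=> ex; have dq : (q %| x)%N.
  have : (q %| x %% (q * (M * l)))%N by rewrite ex -muln_modr dvdn_mulr.
  by rewrite /dvdn modn_dvdm // dvdn_mulr.
exists (x %/ q)%N; first by rewrite mulnC divnK.
apply/eqP; rewrite -(eqn_pmul2l q_gt0) !muln_modr -ex.
by rewrite [(q * _)%N]mulnC divnK.
Qed.

End Class.

(** The relation at y, for y = c mod M and y = b mod l, is a relation at x = q y. Since q = 1 mod M,
    these x form a subclass of c mod M and [lform_extend] applies. *)
Lemma transfer phi : good_shifts phi ->
  ev_mod c M (fun x => lform f phi x = 0) -> ev_mod c M (fun x => lform f (dilate_form phi) x = 0).
Proof.
move=> [b hb] [n0 h]; set y0 := chinese M l c b.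
have l0 := prime_gt0 l_prime; have q0 := q_gt0.
apply: (@lform_extend _ (q * y0) (q * (M * l))%N).
- by rewrite !muln_gt0; apply/and3P.
- by rewrite dvdn_mull ?dvdn_mulr.
- exact: class_qc.
exists (q * n0.+1)%N => x lx /class_qy[y exy ey]; rewrite {}exy in lx *.
rewrite leq_pmul2l // in lx.
rewrite lform_dilate ?h ?mulr0 //; try exact: leq_trans lx; try exact: ltnW.
  rewrite -(class_c b) -/y0.
  by rewrite -(modn_dvdm y (dvdn_mulr l (dvdnn M))) ey modn_dvdm ?dvdn_mulr.
exact: class_good ey.
Qed.

(** Division by f q reverses the argument on the class of [y0], which again extends. *)
Lemma transfer_inv phi : good_shifts phi ->
  ev_mod c M (fun x => lform f (dilate_form phi) x = 0) -> ev_mod c M (fun x => lform f phi x = 0).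
Proof.
move=> [b hb] [n0 h]; set y0 := chinese M l c b.
have l0 := prime_gt0 l_prime; have q0 := q_gt0.
apply: (@lform_extend _ y0 (M * l)%N).
- by rewrite !muln_gt0; apply/andP.
- by rewrite dvdn_mulr.
- exact: class_c.
exists n0.+1 => y ly ey.
have := lform_dilate (leq_trans (ltn0Sn _) ly) (class_good hb ey).
rewrite h; first by move/esym/eqP; rewrite mulf_eq0 (negbTE fq) => /eqP.
  exact: leq_trans (ltnW ly) (leq_pmull _ _).
rewrite -(class_qc b) -/y0 -[RHS]modnMmr -[LHS]modnMmr.
congr ((_ * _) %% _)%N.
by rewrite -(modn_dvdm y (dvdn_mulr l (dvdnn M))) ey modn_dvdm ?dvdn_mulr.
Qed.

End Transfer.

(** * Logarithmic height of the shifts *)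

Section Height.
Variables (K : numClosedFieldType) (f : nat -> K).
Hypothesis f_mult : multiplicative_fun f.
Variables (c M r : nat) (J : 'I_r -> nat).
Hypotheses (M_gt0 : (0 < M)%N) (genJ : gen f c M J) (indJ : indep f c M J).
Variables (l e Jb : nat).
Let q := (l ^ e)%N.
Hypotheses (l_prime : prime l) (e_gt0 : (0 < e)%N) (Ml : coprime M l).
Hypotheses (q1 : q = 1 %[mod M]) (fq : f q != 0).
Hypotheses (J_lt : forall i, (J i < Jb)%N) (Jb_lt : (Jb.+2 < l)%N).

Definition height k h := exists2 D : {poly K}, D != 0 & exists u : 'I_r -> {poly K},
  [/\ (size D <= h)%N, forall i, (size (u i) <= h)%N &
   ev_mod c M (fun x => D.[x%:R] * f (x + k)%N = \sum_i (u i).[x%:R] * f (x + J i)%N)].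

Lemma height_le k h h' : (h <= h')%N -> height k h -> height k h'.
Proof.
move=> hh [D D0 [u [sD su E]]]; exists D => //; exists u.
by split => // [|i]; exact: leq_trans hh.
Qed.

Lemma height_exists k : exists h, height k h.
Proof.
have [D D0 [u E]] := genJ k; exists (maxn (size D) (\max_i size (u i))).
exists D => //; exists u; split => // [|i]; first exact: leq_maxl.
apply: leq_trans (leq_maxr _ _).
exact: (@leq_bigmax _ (fun i => size (u i))).
Qed.

Lemma common_denominator (I : finType) (F : I -> nat -> K) :
  (forall a, spanned f nonzero c M J (F a)) ->
  exists2 D : {poly K}, D != 0 & exists u : I -> 'I_r -> {poly K},
    forall a, ev_mod c M (fun x => D.[x%:R] * F a x = \sum_i (u a i).[x%:R] * f (x + J i)%N).
Proof.
move=> g.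
have /choice[Du h] a : exists Du : {poly K} * ('I_r -> {poly K}), Du.1 != 0 /\
    ev_mod c M (fun x => Du.1.[x%:R] * F a x = \sum_i (Du.2 i).[x%:R] * f (x + J i)%N).
  by have [D D0 [u E]] := g a; exists (D, u).
exists (\prod_a (Du a).1).
  by rewrite prodf_seq_neq0; apply/allP => a _; have [] := h a.
exists (fun a i => (\prod_(a' | a' != a) (Du a').1) * (Du a).2 i) => a.
have [_ E] := h a; apply: ev_imp E => x E.
rewrite (bigD1 a) //= hornerM mulrAC E mulr_suml; apply: eq_bigr => i _.
by rewrite hornerM mulrC mulrA.
Qed.

(** Dilation and shift preserve degrees. The only cost is rewriting the finitely many f (x + (M j +
    q J i)), j < q, in the basis, and it does not depend on s. *)
Lemma height_step : exists h0, forall j s h, (j < q)%N ->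
  height s h -> height (M * j + q * s) (h + h0).
Proof.
pose F (a : 'I_q * 'I_r) x := f (x + (M * a.1 + q * J a.2))%N.
have [D D0 [v E]] : exists2 D : {poly K}, D != 0 & exists v : 'I_q * 'I_r -> 'I_r -> {poly K},
    forall a, ev_mod c M (fun x => D.[x%:R] * F a x = \sum_i (v a i).[x%:R] * f (x + J i)%N).
  by apply: common_denominator => a; exact: genJ.
exists (maxn (size D) (\max_a \max_i size (v a i))) => j s h jq [Ds Ds0 [u [sD su Es]]].
set h0 := maxn _ _; have q0 : (0 < q)%N := q_gt0 e l_prime.
have T : ev_mod c M (fun x => (dilp q Ds).[x%:R] * f (x + q * s)%N =
    \sum_i (dilp q (u i)).[x%:R] * f (x + q * J i)%N).
  have := @transfer _ f f_mult c M r J M_gt0 genJ indJ l e l_prime e_gt0 Ml q1 fq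
    ((Ds, s) :: [seq (- u i, J i) | i <- index_enum 'I_r]).
  case.
  - have hb b i : (0 < b <= 2)%N -> ~~ (l %| b + J i)%N.
      move=> b12; apply/negP => /dvdn_leq; have := J_lt i; lia.
    (* Since l cannot divide two consecutive integers, b = 1 or b = 2 suits s; both suit the [J i],
       because 0 < b + J i < l. *)
    have [b b12 lb] : exists2 b, (0 < b <= 2)%N & ~~ (l %| b + s)%N.
      case: (boolP (l %| 1 + s)%N) => [d1|]; [exists 2%N | exists 1%N] => //.
      apply/negP => d2; have : (l %| 2 + s - (1 + s))%N by exact: dvdn_sub.
      by rewrite subnDr dvdn1 => /eqP l1; move: Jb_lt; rewrite l1.
    exists b => p; rewrite inE => /orP[/eqP -> //|/mapP[i _ ->]]; exact: hb.
  - apply: ev_imp Es => x Es; rewrite lform_cons /lform big_map Es -big_split big1 //= => i _.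
    by rewrite hornerN mulNr subrr.
  move=> n0 T; exists n0 => x lx ex; have := T x lx ex.
  rewrite /dilate_form /= lform_cons /lform -map_comp big_map /= => /eqP.
  rewrite addr_eq0 => /eqP ->; rewrite -sumrN; apply: eq_bigr => i _.
  by rewrite !dilp_eval hornerN mulNr opprK.
exists (D * shiftp (M * j) (dilp q Ds)).
  by rewrite mulf_neq0 // shiftp_eq0 dilp_eq0.
exists (fun i => \sum_i' shiftp (M * j) (dilp q (u i')) * v (Ordinal jq, i') i); split.
- apply: leq_trans (size_polyMleq _ _) _.
  rewrite size_shiftp size_dilp // (leq_trans (leq_pred _)) // addnC leq_add //.
  exact: leq_maxl.
- move=> i; apply: leq_trans (size_sum _ _ _) _; apply/bigmax_leqP => i' _.
  apply: leq_trans (size_polyMleq _ _) _.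
  rewrite size_shiftp size_dilp // (leq_trans (leq_pred _)) // leq_add //.
  apply: leq_trans (leq_maxr _ _).
  apply: leq_trans (@leq_bigmax _ (fun a => \max_i size (v a i)) (Ordinal jq, i')).
  exact: (@leq_bigmax _ (fun i => size (v (Ordinal jq, i') i))).
have E' : ev_mod c M (fun x => forall i', D.[x%:R] * F (Ordinal jq, i') x =
   \sum_i (v (Ordinal jq, i') i).[x%:R] * f (x + J i)%N).
  by apply: ev_all => i'; exact: E.
apply: ev_imp (ev_and E' (ev_shift (dvdn_mulr j (dvdnn M)) T)) => x [Ex Tx].
rewrite hornerM -mulrA shiftp_evaln addnA Tx.
under [RHS]eq_bigr => i _ do rewrite horner_sum mulr_suml.
rewrite exchange_big mulr_sumr; apply: eq_bigr => i' _ /=.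
rewrite mulrCA -addnA Ex mulr_sumr; apply: eq_bigr => i _.
by rewrite hornerM shiftp_evaln mulrA.
Qed.

(** Every k >= M q is M j + q s with j < q and s <= k / 2, so [height_step] is applied O(log k)
    times. *)
Lemma height_log : exists h, forall k, height k (h * (1 + trunc_log 2 k)).
Proof.
have [h0 step] := height_step; have /choice[hk Hk] := height_exists.
have q0 : (0 < q)%N := q_gt0 e l_prime.
have q_gt1 : (1 < q)%N by rewrite -(exp1n e) ltn_exp2r // prime_gt1.
pose h := maxn h0 (\max_(k < M * q) hk k); exists h.
elim/ltn_ind => k IH; have [lk|gk] := ltnP k (M * q)%N.
  apply: height_le (Hk k); apply: leq_trans (leq_pmulr _ _) => //.
  apply: leq_trans (leq_maxr _ _).
  exact: (@leq_bigmax _ (fun k : 'I_(M * q) => hk k) (Ordinal lk)).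
have Mq : coprime M q by rewrite coprimeXr.
(* As [a] is 0 mod M and k mod q, the residue j of a / M modulo q satisfies M j = k mod q. *)
pose a := chinese M q 0 k.
have Ma : (M %| a)%N by apply/eqP; rewrite -[RHS](mod0n M); exact: chinese_modl.
pose j := (a %/ M %% q)%N.
have jq : (j < q)%N by rewrite ltn_mod.
have ej : (M * j)%N = k %[mod q].
  by rewrite modnMmr mulnC divnK //; exact: chinese_modr.
have lj : (M * j <= k)%N by apply: leq_trans gk; rewrite leq_mul2l ltnW // orbT.
have [s es] : exists s, k = (M * j + q * s)%N.
  exists ((k - M * j) %/ q)%N; rewrite [(q * _)%N]mulnC divnK ?subnKC //.
  by rewrite -eqn_mod_dvd // eq_sym; apply/eqP.
have ls : (s <= k./2)%N.
  rewrite geq_half_double -muln2 mulnC es (leq_trans _ (leq_addl _ _)) //.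
  by rewrite leq_mul2r q_gt1 orbT.
have lk2 : (1 < k)%N by apply: leq_trans gk; apply: leq_trans q_gt1 (leq_pmull _ _).
have lsk : (s < k)%N.
  by apply: leq_ltn_trans ls _; rewrite ltn_half_double -addnn; lia.
rewrite {1}es; apply: height_le (step _ _ _ jq (IH s lsk)).
rewrite (trunc_log2S lk2) !add1n addnC [leqRHS]mulnS leq_add //; first exact: leq_maxl.
by rewrite leq_mul2l ltnS leq_trunc_log ?orbT.
Qed.

End Height.

(** * Localisation of the poles *)

Lemma log_lt_linear A B C : exists N, (A * (1 + trunc_log 2 (B * N + C)) < N)%N.
Proof.
suff [n hn] : exists n, (A * (1 + (n + (B + C))) < 2 ^ n)%N.
  exists (2 ^ n)%N; apply: leq_ltn_trans hn; rewrite leq_mul2l leq_add2l; apply/orP; right.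
  have le : (B * 2 ^ n + C <= 2 ^ (n + (B + C)))%N.
    rewrite expnD; apply: (@leq_trans (2 ^ n * (B + C))%N).
      by rewrite mulnDr leq_add // ?leq_pmull ?expn_gt0 // mulnC.
    by rewrite leq_mul2l (ltnW (ltn_expl _ _)) ?orbT.
  by apply: leq_trans (leq_trunc_log 2 le) _; rewrite trunc_expnK.
have h n : (n * n <= 2 ^ n + n)%N.
  have h4 k : ((k + 4) * (k + 4) <= 2 ^ (k + 4))%N.
    elim: k => // k IH; rewrite addSn expnS; move: (2 ^ _)%N IH => w; nia.
  case: n => [|[|[|[|n]]]] //; have := h4 n; rewrite addn4; lia.
exists (A * (B + C + 3) + A + 2)%N; set s := (B + C)%N.
set n := (_ + _ + 2)%N; have := h n; move: (2 ^ n)%N => w; rewrite /n; nia.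
Qed.

Section Poles.
Variables (K : numClosedFieldType) (f : nat -> K) (c M : nat).
Variables (R : nat) (P : nat -> {poly K}) (n0 : nat).
Hypotheses (M_gt0 : (0 < M)%N) (R_gt0 : (0 < R)%N) (P0 : P 0%N != 0) (PR : P R != 0).
Hypothesis rec : forall x, (n0 <= x)%N ->
  \sum_(i < R.+1) (P i).[x%:R] * f (x + i)%N = 0.

Definition window m (i : 'I_R) := (m + i)%N.
(** Regularity of v at z relative to the frame of R shifts starting at m. Moving the frame by one
    step can create a pole only if [P 0] or [P R] vanishes at z + m. *)
Definition L z m v := spanned f (nonzero_at z) c M (window m) v.

Lemma rec_shift m : ev_mod c M (fun x =>
  \sum_(i < R.+1) (shiftp m (P i)).[x%:R] * f (x + (m + i))%N = 0).
Proof.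
exists n0 => x lx _; rewrite -[RHS](@rec (x + m)%N); last by rewrite (leq_trans lx) ?leq_addr.
by apply: eq_bigr => i _; rewrite shiftp_evaln addnA.
Qed.

(** The generator f (x + (m + R)) is eliminated by the recurrence at x + m; multiplying by the
    leading coefficient replaces a division that could create a pole. *)
Lemma L_down1_mul z m v : L z m.+1 v -> L z m (fun x => (shiftp m (P R)).[x%:R] * v x).
Proof.
apply: (spanned_trans_mul (nonzero_atM z)) => i.
have [iR|Ri] := ltnP i.+1 R.
  apply: spanned_mul.
  by have := spanned_base f (nonzero_atM z) c M (window m) (Ordinal iR); rewrite /window /= addnS.
have eR : (m.+1 + i = m + R)%N by have := ltn_ord i; lia.
exists 1; first exact: (nonzero_atM z).1.
exists (fun j => - shiftp m (P j)); apply: ev_imp (rec_shift m) => x.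
rewrite big_ord_recr /= addrC => /eqP; rewrite addr_eq0 /window eR => /eqP ->.
by rewrite hornerE mul1r -sumrN; apply: eq_bigr => j _; rewrite hornerN mulNr.
Qed.

Lemma L_down1 z m v : (P R).[z + m%:R] != 0 -> L z m.+1 v -> L z m v.
Proof.
move=> PRz /L_down1_mul; apply: (spanned_div (nonzero_atM z)).
by rewrite /nonzero_at shiftp_eval.
Qed.

Lemma L_up1 z m v : (P 0%N).[z + m%:R] != 0 -> L z m v -> L z m.+1 v.
Proof.
move=> P0z; apply: (spanned_trans (nonzero_atM z)) => -[[|i] iR]; rewrite /window /=; last first.
  have := spanned_base f (nonzero_atM z) c M (window m.+1) (Ordinal (ltnW iR)).
  by rewrite /window /= addSnnS.
exists (shiftp m (P 0%N)); first by rewrite /nonzero_at shiftp_eval.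
exists (fun j => - shiftp m (P j.+1)); apply: ev_imp (rec_shift m) => x.
rewrite big_ord_recl /= => /eqP; rewrite addr_eq0 => /eqP ->.
rewrite -sumrN; apply: eq_bigr => j _; rewrite hornerN mulNr.
by rewrite /bump /= add1n addSnnS.
Qed.

Lemma L_down z m m' v : (forall j, (m <= j < m')%N -> (P R).[z + j%:R] != 0) ->
  (m <= m')%N -> L z m' v -> L z m v.
Proof.
move=> h lm; rewrite -(subnKC lm) in h *; elim: (m' - m)%N h => [|d IH] h.
  by rewrite addn0.
rewrite addnS => /L_down1 Ld; apply: IH => [j /andP[h1 h2]|].
  by apply: h; rewrite h1 addnS ltnW.
by apply: Ld; apply: h; rewrite leq_addr addnS /=.
Qed.

Lemma L_up z m m' v : (forall j, (m <= j < m')%N -> (P 0%N).[z + j%:R] != 0) ->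
  (m <= m')%N -> L z m v -> L z m' v.
Proof.
move=> h lm Lm; rewrite -(subnKC lm) in h *; elim: (m' - m)%N h => [|d IH] h.
  by rewrite addn0.
rewrite addnS; apply: L_up1; first by apply: h; rewrite leq_addr addnS /=.
by apply: IH => j /andP[h1 h2]; apply: h; rewrite h1 addnS ltnW.
Qed.

Lemma L_mul z m (p : {poly K}) v : L z m v -> L z m (fun x => p.[x%:R] * v x).
Proof. exact: spanned_mul. Qed.

Lemma L_ext z m v v' : (forall x, v x = v' x) -> L z m v -> L z m v'.
Proof. by move=> e; apply: spanned_ext; exact: ev_true. Qed.

Lemma L_down_mul z m d v : L z (m + d) v ->
  L z m (fun x => (\prod_(j < d) shiftp (m + j) (P R)).[x%:R] * v x).
Proof.
elim: d v => [|d IH] v Lv.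
  by rewrite addn0 in Lv; apply: L_ext Lv => x; rewrite big_ord0 hornerE mul1r.
apply: (@L_ext _ _ (fun x => (\prod_(j < d) shiftp (m + j) (P R)).[x%:R] *
  ((shiftp (m + d) (P R)).[x%:R] * v x))).
  by move=> x; rewrite big_ord_recr /= hornerM mulrA.
by apply: IH; rewrite addnS in Lv; exact: L_down1_mul.
Qed.


Lemma L_shift z m t v : (M %| t)%N ->
  L z m v <-> L (z - t%:R) (m + t) (fun x => v (x + t)%N).
Proof.
move=> Mt; split=> -[D Dz [u E]].
  exists (shiftp t D); first by rewrite /nonzero_at shiftp_eval subrK.
  exists (fun i => shiftp t (u i)); apply: ev_imp (ev_shift Mt E) => x Ex.
  rewrite shiftp_evaln Ex; apply: eq_bigr => i _; rewrite shiftp_evaln /window.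
  by congr (_ * f _); lia.
pose p_ := fun p : {poly K} => p \Po ('X - t%:R%:P).
have pE p (x : K) : (p_ p).[x] = p.[x - t%:R] by rewrite horner_comp !hornerE.
exists (p_ D); first by rewrite /nonzero_at pE.
exists (fun i => p_ (u i)); apply: (ev_unshift Mt); apply: ev_imp E => x Ex.
rewrite pE natrD addrK Ex; apply: eq_bigr => i _; rewrite pE addrK /window.
by congr (_ * f _); lia.
Qed.

Definition sing := P 0%N * P R.

Lemma sing_neq0 z : sing.[z] != 0 -> (P 0%N).[z] != 0 /\ (P R).[z] != 0.
Proof. by rewrite hornerM mulf_eq0 negb_or => /andP[]. Qed.

Variable h : nat.
Hypothesis few_poles : forall k, exists2 D : {poly K}, D != 0 &
  (size D <= h * (1 + trunc_log 2 k))%N /\ exists u : 'I_R -> {poly K},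
  ev_mod c M (fun x => D.[x%:R] * f (x + k)%N = \sum_i (u i).[x%:R] * f (x + i)%N).

(* The singularities of the recurrence along the orbit z + Z all lie in [z, z + k[.
   Seen from z - M t, for all t < N, the element f (x + (M N + k + i)) crosses
   all of them; if it had a pole at z - M t for each t < N its denominator
   would have degree at least N, but that degree is only logarithmic in N. *)
Lemma L_transport z k v :
  (forall j, sing.[z + j%:R] = 0 -> (j < k)%N) ->
  (forall t, (0 < t)%N -> sing.[z - t%:R] != 0) ->
  L z k v -> L z 0 v.
Proof.
move=> bad_lt bad_neg Lv.
(* N is larger than the total degree of the denominators of the f (x + (n + i)), i < R; hence at
   some z - M t with t < N all of them are regular. *)
have [N hN] := log_lt_linear (R * h) M (k + R).
pose n := (M * N + k)%N.
have /choice[Du hDu] (i : 'I_R) : exists Du : {poly K} * ('I_R -> {poly K}),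
    [/\ Du.1 != 0, (size Du.1 <= h * (1 + trunc_log 2 (M * N + (k + R))))%N &
    ev_mod c M (fun x => Du.1.[x%:R] * f (x + (n + i))%N = \sum_j (Du.2 j).[x%:R] * f (x + j)%N)].
  have [D D0 [sD [u E]]] := few_poles (n + i).
  exists (D, u); split => //; apply: leq_trans sD _.
  rewrite leq_mul2l leq_add2l leq_trunc_log ?orbT // /n -addnA leq_add2l leq_add2l.
  by rewrite ltnW ?ltn_ord.
pose D := \prod_i (Du i).1.
have D0 : D != 0 by rewrite prodf_seq_neq0; apply/allP => i _; have [] := hDu i.
have sD : (size D <= N)%N.
  apply: leq_trans (size_poly_prod_leq _ _) _.
  apply: leq_trans (leq_subr _ _) _; apply: leq_ltn_trans hN.
  apply: (@leq_trans (\sum_(i < R) (h * (1 + trunc_log 2 (M * N + (k + R)))))).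
    by apply: leq_sum => i _; have [] := hDu i.
  by rewrite sum_nat_const card_ord mulnA.
have [t tN Dt] : exists2 t, (t < N)%N & D.[z - (M * t)%:R] != 0.
  apply: contrapT => no; pose rs := [seq z - (M * t)%:R | t <- iota 0 N].
  suff: (size rs < size D)%N by rewrite size_map size_iota ltnNge sD.
  apply: max_poly_roots => //.
    apply/allP => x /mapP[t]; rewrite mem_iota /= => tN ->.
    by apply/negPn/negP => Dt; apply: no; exists t.
  rewrite map_inj_uniq ?iota_uniq // => i j /addrI /oppr_inj /natf_inj /eqP.
  by rewrite eqn_pmul2l // => /eqP.
pose z' := z - (M * t)%:R.
have zE j : (M * t <= j)%N -> z' + j%:R = z + (j - M * t)%:R.
  by move=> lj; rewrite natrB // /z' addrAC addrA.
(* From frame 0 to frame M t, the points z' + j crossed are of the form z - s with s > 0, where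
   [sing] has no zero. *)
have gens (i : 'I_R) : L z' (M * t) (fun x => f (x + (n + i))%N).
  apply: (@L_up _ 0) => // [j /= lj|].
    apply: (sing_neq0 _).1; have -> : z' + j%:R = z - (M * t - j)%:R.
      by rewrite /z' natrB ?(ltnW lj) // opprB addrA addrAC.
    by apply: bad_neg; rewrite subn_gt0.
  exists (Du i).1; last by exists (Du i).2; have [] := hDu i.
  rewrite /nonzero_at -/z'; apply: contraNneq Dt => e0; rewrite horner_prod.
  by rewrite (bigD1 i) //= -/z' e0 mul0r.
apply/(@L_shift z 0 (M * t)); first exact: dvdn_mulr.
apply: (spanned_trans (nonzero_atM _) gens).
(* Seen from z', [v] climbs from frame k + M t to frame n across points z + j with j >= k, beyond
   all singularities. *)
have /(_ (dvdn_mulr _ (dvdnn M)))/iffLR/(_ Lv) := @L_shift z k (M * t) v.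
apply: L_up => [j /andP[lj _]|]; last by rewrite /n addnC leq_add2r leq_mul2l ltnW ?orbT.
apply: (sing_neq0 _).1; have lj' : (M * t <= j)%N by lia.
rewrite zE //; apply/eqP => /bad_lt; lia.
Qed.

Variable Jw : nat.
Hypothesis sing_diam : forall z d, sing.[z] = 0 -> sing.[z + d%:R] = 0 -> (d < Jw)%N.

(** In a descent from frame k to frame 0, [pole_left] collects the factors of the last Jw steps, and
    [pole_right], taken at x + k, those of the first Jw steps. *)
Definition pole_left := \prod_(j < Jw) shiftp j (P R).
Definition pole_right := \prod_(j < Jw) (P R \Po ('X - j.+1%:R%:P)).

Lemma pole_right_neq0 : pole_right != 0.
Proof.
rewrite prodf_seq_neq0; apply/allP => j _ /=.
by rewrite -size_poly_eq0 size_comp_poly2 ?size_XsubC // size_poly_eq0.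
Qed.

Lemma L_split z d e v : (d <= e)%N ->
  L z 0 (fun x => (\prod_(j < d) shiftp j (P R)).[x%:R] * v x) ->
  L z 0 (fun x => (\prod_(j < e) shiftp j (P R)).[x%:R] * v x).
Proof.
move=> /subnKC <-; move/(L_mul (\prod_(j < e - d) shiftp (d + j) (P R))).
apply: L_ext => x; rewrite big_split_ord /= hornerM; rewrite mulrA; congr (_ * _).
by rewrite mulrC.
Qed.

(** The singularities on z + Z are less than Jw apart. If one is left of z, the descent from k meets
    only those at z + j with j < Jw; if one is at z + j with j >= k, only those in the last Jw
    places before z + k. Otherwise all lie in [z, z + k[ and [L_transport] excludes a pole. *)
Lemma L_poles z k :
  L z 0 (fun x => pole_left.[x%:R] * (pole_right.[(x + k)%:R] * f (x + k)%N)).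
Proof.
have Lk : L z k (fun x => f (x + k)%N).
  have := spanned_base f (nonzero_atM z) c M (window k) (Ordinal R_gt0).
  by rewrite /window addn0.
have sing_down m : (forall j, (m <= j < k)%N -> sing.[z + j%:R] != 0) -> (m <= k)%N ->
    L z m (fun x => f (x + k)%N).
  by move=> hs lm; apply: (L_down _ lm Lk) => j /hs /sing_neq0[].
have [[t t0 zt]|neg] := EM (exists2 t, (0 < t)%N & sing.[z - t%:R] = 0).
  apply: (@L_ext _ _ (fun x => (shiftp k pole_right).[x%:R] * (pole_left.[x%:R] * f (x + k)%N))).
    by move=> x; rewrite shiftp_evaln mulrCA.
  apply: L_mul; have [lkJ|lJk] := leqP k Jw.
    by apply: (L_split lkJ); exact: (@L_down_mul _ 0 k).
  apply: (@L_down_mul _ 0 Jw); rewrite add0n; apply: sing_down (ltnW lJk).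
  move=> j /andP[lj _]; apply/eqP => zj.
  have /(sing_diam zt) : sing.[z - t%:R + (t + j)%:R] = 0 by rewrite natrD addrA subrK.
  lia.
have {}neg t : (0 < t)%N -> sing.[z - t%:R] != 0.
  by move=> t0; apply/eqP => zt; apply: neg; exists t.
apply: L_mul.
have [[j lj zj]|no] := EM (exists2 j, (k <= j)%N & sing.[z + j%:R] = 0).
  pose d := minn k Jw; have ld : (d <= k)%N := geq_minl _ _.
  have ldJ : (d <= Jw)%N := geq_minr _ _.
  (* The factors of [pole_right] are split into the d consumed by the descent from k to k - d and a
     surplus of Jw - d. *)
  apply: (@L_ext _ _ (fun x => (\prod_(i < Jw - d) (P R \Po ('X + (k%:R - (d + i).+1%:R)%:P))).[x%:R] *
    ((\prod_(i < d) shiftp (k - d + i) (P R)).[x%:R] * f (x + k)%N))).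
    move=> x; rewrite mulrA; congr (_ * _); rewrite /pole_right.
    rewrite [in RHS](_ : Jw = d + (Jw - d))%N; last by rewrite subnKC.
    rewrite big_split_ord /= hornerM mulrC; congr (_ * _); rewrite !horner_prod; last first.
      by apply: eq_bigr => i _; rewrite !horner_comp hornerXsubC hornerD hornerX hornerC natrD addrA.
    rewrite (reindex_inj rev_ord_inj) /=; apply: eq_bigr => i _.
    rewrite shiftp_eval horner_comp hornerXsubC; congr ((P R).[_]).
    have li := ltn_ord i; have -> : (k - d + (d - i.+1) = k - i.+1)%N by lia.
    by rewrite natrB ?(leq_trans li) // natrD addrA.
  apply: L_mul; apply: (@L_down _ 0 (k - d)) => //; last first.
    by apply: L_down_mul; rewrite subnK.
  move=> i /= li; apply: (sing_neq0 _).2; apply/eqP => zi.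
  have lij : (i <= j)%N by lia.
  have /(sing_diam zi) : sing.[z + i%:R + (j - i)%:R] = 0 by rewrite -addrA -natrD subnKC.
  by rewrite /d in li *; lia.
apply: (@L_ext _ _ (fun x => (shiftp k pole_right).[x%:R] * f (x + k)%N)).
  by move=> x; rewrite shiftp_evaln.
apply: L_mul; apply: L_transport neg Lk => j zj; rewrite ltnNge; apply/negP => lj.
by apply: no; exists j.
Qed.

(** The D for which D v is a polynomial combination of the generators form an ideal without common
    zero; gcds lower the degree of an element until it is constant. *)
Lemma local_global v : (forall z, L z 0 v) ->
  exists u : 'I_R -> {poly K}, ev_mod c M (fun x => v x = \sum_i (u i).[x%:R] * f (x + i)%N).
Proof.
move=> loc; pose I (D : {poly K}) := exists u : 'I_R -> {poly K},
  ev_mod c M (fun x => D.[x%:R] * v x = \sum_i (u i).[x%:R] * f (x + i)%N).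
have I_comb (a b D D' : {poly K}) : I D -> I D' -> I (a * D + b * D').
  move=> [u E] [u' E']; exists (fun i => a * u i + b * u' i).
  apply: ev_imp (ev_and E E') => x [e e'].
  rewrite hornerD !hornerM mulrDl -!mulrA e e' !mulr_sumr -big_split.
  by apply: eq_bigr => i _; rewrite hornerD !hornerM mulrDl !mulrA.
have IL z : exists2 D, D.[z] != 0 & I D by have [D Dz [u E]] := loc z; exists D => //; exists u.
suff H n : forall D : {poly K}, D != 0 -> (size D <= n)%N -> I D -> I 1.
  have [D Dz ID] := IL 0; have [|u E] := H (size D) D _ (leqnn _) ID.
    by apply: contraNneq Dz => ->; rewrite hornerE.
  by exists u; apply: ev_imp E => x; rewrite hornerE mul1r.
elim: n => [|n IH] D D0 sD ID.
  by rewrite leqn0 size_poly_eq0 (negbTE D0) in sD.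
have [/size_poly1P[a a0 Da]|s1] := boolP (size D == 1)%N.
  have -> : 1 = a^-1%:P * D + 0 * D by rewrite mul0r addr0 Da -polyCM mulVf.
  exact: I_comb.
have [z Dz] := closed_rootP D s1.
have [D' D'z ID'] := IL z.
have [[a b] /= ab] := Bezoutp D D'.
apply: (IH (a * D + b * D')); last exact: I_comb.
  by rewrite -size_poly_eq0 (eqp_size ab) size_poly_eq0 gcdp_eq0 (negbTE D0).
rewrite (eqp_size ab) -ltnS; apply: leq_trans sD.
rewrite ltn_neqAle dvdp_leq ?dvdp_gcdl // andbT.
apply: contra D'z => /eqP sg; have : gcdp D D' %= D by rewrite -dvdp_size_eqp ?dvdp_gcdl ?sg.
by move=> /eqp_dvdl e; have := dvdp_gcdr D D'; rewrite e => /root_dvdp; apply.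
Qed.

Lemma pole_bound k : exists u : 'I_R -> {poly K}, ev_mod c M (fun x =>
  pole_left.[x%:R] * (pole_right.[(x + k)%:R] * f (x + k)%N) =
  \sum_i (u i).[x%:R] * f (x + i)%N).
Proof. by apply: local_global => z; exact: L_poles. Qed.

End Poles.

(** * Facts on polynomials *)

Section PolynomialFacts.
Variable K : numClosedFieldType.
Implicit Types (p : {poly K}).

Lemma lead_coef_shiftp k p : lead_coef (shiftp k p) = lead_coef p.
Proof. by rewrite lead_coef_comp ?size_XaddC // lead_coefXaddC expr1n mulr1. Qed.

Lemma size_shiftp_sub k p : p != 0 -> (size (shiftp k p - p)%R < size p)%N.
Proof.
move=> p0; have sp : (0 < size p)%N by rewrite size_poly_gt0.
rewrite -(prednK sp) ltnS; apply/leq_sizeP => j; rewrite leq_eqVlt => /orP[/eqP <-|lj].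
  rewrite coefB -lead_coefE -(size_shiftp k) -lead_coefE lead_coef_shiftp.
  by rewrite subrr.
by rewrite coefB !nth_default ?subrr ?size_shiftp // -(prednK sp).
Qed.

(** The expansion of (X + a)^(n+1) without its two top terms, which is the error made when
    differencing a power of X. *)
Definition binomial_tail (a : K) n : {poly K} :=
  ('X + a%:P) ^+ n.+1 - 'X^(n.+1) - (a *+ n.+1)%:P * 'X^n.

Lemma size_binomial_tail a n : (size (binomial_tail a n) <= n)%N.
Proof.
rewrite /binomial_tail; elim: n => [|n IH].
  by rewrite !expr1 expr0 mulr1 mulr1n addrAC addrK subrr size_poly0.
have -> : ('X + a%:P) ^+ n.+2 - 'X^(n.+2) - (a *+ n.+2)%:P * 'X^(n.+1) =
    ('X + a%:P) * (('X + a%:P) ^+ n.+1 - 'X^(n.+1) - (a *+ n.+1)%:P * 'X^n)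
    + (a * (a *+ n.+1))%:P * 'X^n.
  rewrite [a *+ n.+2]mulrS polyCD polyCM [('X + _) ^+ n.+2]exprS ['X^(n.+2)]exprS ['X^(n.+1)]exprS.
  by move: ((a *+ _)%:P) ((_ + _) ^+ n.+1) ('X^n) => u w v; ring.
rewrite (leq_trans (size_polyD _ _)) // geq_max; apply/andP; split.
  by rewrite (leq_trans (size_polyMleq _ _)) // size_XaddC.
by rewrite mul_polyC (leq_trans (size_scale_leq _ _)) // size_polyXn.
Qed.

Lemma antidifference k p : (0 < k)%N -> exists U, shiftp k U - U = p.
Proof.
move=> k0; have [N] := ubnP (size p); elim: N p => // N IH p; rewrite ltnS => sp.
have [->|p0] := eqVneq p 0; first by exists 0; rewrite /shiftp comp_poly0 subrr.
have [d ed] : exists d, size p = d.+1 by exists (size p).-1; rewrite prednK ?size_poly_gt0.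
have nz : k%:R *+ d.+1 != 0 :> K by rewrite -mulrnA pnatr_eq0 muln_eq0; lia.
(* The difference of X^(d+1) with step k has leading term k (d + 1) X^d, so this multiple cancels
   the leading term of p. *)
pose a := p`_d / (k%:R *+ d.+1).
have [|U hU] := IH (p - (shiftp k (a *: 'X^(d.+1)) - a *: 'X^(d.+1))).
  apply: leq_trans sp; rewrite ed ltnS.
  have -> : p - (shiftp k (a *: 'X^(d.+1)) - a *: 'X^(d.+1)) = (p - p`_d *: 'X^d) -
      a *: binomial_tail k%:R d.
    have -> : p`_d = a * (k%:R *+ d.+1) by rewrite divfK.
    rewrite /binomial_tail /shiftp comp_polyZ comp_Xn_poly -!mul_polyC polyCM.
    by move: (a%:P) ((_ *+ _)%:P) ((_ + _) ^+ _) ('X^d) ('X^(d.+1)) => u1 u2 u3 u4 u5; ring.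
  rewrite (leq_trans (size_polyD _ _)) // geq_max size_polyN.
  rewrite (leq_trans (size_scale_leq _ _) (size_binomial_tail _ _)) andbT.
  apply/leq_sizeP => j; rewrite leq_eqVlt coefB coefZ coefXn => /orP[/eqP <-|lj].
    by rewrite eqxx mulr1 subrr.
  by rewrite nth_default ?ed // gtn_eqF // mulr0 subr0.
exists (U + a *: 'X^(d.+1)); rewrite {1}/shiftp comp_polyD -/(shiftp k U) -/(shiftp k (a *: _)).
by rewrite opprD addrACA hU subrK.
Qed.

Lemma sing_diam_exists p : p != 0 ->
  exists B, forall z d, p.[z] = 0 -> p.[z + d%:R] = 0 -> (d < B)%N.
Proof.
move=> p0; have [rs e] := closed_field_poly_normal p.
have hB (zz : K * K) : exists B : nat, forall d : nat, zz.2 = zz.1 + d%:R -> (d < B)%N.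
  have [[d hd]|no] := EM (exists d : nat, zz.2 = zz.1 + d%:R).
    by exists d.+1 => d' hd'; move: hd; rewrite hd' => /addrI /natf_inj ->.
  by exists 0%N => d hd; case: no; exists d.
have /= {hB}/choice[B hB] := hB.
exists (\max_(z <- [seq (a, b) | a <- rs, b <- rs]) B z) => z d z0 zd0.
have in_rs y : p.[y] = 0 -> y \in rs.
  move/eqP; rewrite -/(root p y) e rootZ ?lead_coef_eq0 //.
  by rewrite root_prod_XsubC.
have := hB (z, z + d%:R) d erefl; move/leq_trans; apply.
by apply: leq_bigmax_seq => //; apply: allpairs_f; exact: in_rs.
Qed.

(** The operator v(t + 1) - mu_i v(t) lowers the degree of E_i and raises no other, so by induction
    its output is zero. Leading coefficients then give E_j = 0 for j != i, as mu_j != mu_i, and only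
    E_i remains. *)
Lemma exp_poly_indep n (mu : 'I_n -> K) (E : 'I_n -> {poly K}) :
  injective mu -> (forall i, mu i != 0) ->
  (forall t : nat, \sum_i (E i).[t%:R] * mu i ^+ t = 0) -> forall i, E i = 0.
Proof.
move=> mu_inj mu0; have [N] := ubnP (\sum_i size (E i)).
elim: N E => // N IH E; rewrite ltnS => sE hE i; apply/eqP; apply: contraT => Ei.
pose E' j := mu j *: shiftp 1 (E j) - mu i *: E j.
have E'0 : forall j, E' j = 0.
  apply: IH => [|t].
    apply: leq_trans sE; rewrite [leqRHS](bigD1 i) // [X in X.+1](bigD1 i) //= -addSn leq_add //.
      by rewrite /E' -scalerBr size_scale // size_shiftp_sub.
    apply: leq_sum => j _; rewrite (leq_trans (size_polyD _ _)) // geq_max size_polyN.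
    by rewrite !(leq_trans (size_scale_leq _ _)) ?size_shiftp.
  transitivity (\sum_j (E j).[t.+1%:R] * mu j ^+ t.+1 - mu i * \sum_j (E j).[t%:R] * mu j ^+ t).
    rewrite mulr_sumr -sumrB.
    by apply: eq_bigr => j _; rewrite /E' hornerD hornerN !hornerZ shiftp_evaln addn1 exprS; ring.
  by rewrite !hE mulr0 subrr.
have Ej j : j != i -> E j = 0.
  move=> ji; apply/eqP; rewrite -lead_coef_eq0; apply: contraT => lj.
  have := E'0 j => /eqP; rewrite subr_eq0 => /eqP /(congr1 lead_coef).
  rewrite !lead_coefZ lead_coef_shiftp => /(mulIf lj) /mu_inj /eqP; by rewrite (negbTE ji).
move: Ei; rewrite (_ : E i = 0) ?eqxx //; apply: (@poly_ev0 _ 0 1) => //.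
exists 0%N => t _ _; have := hE t; rewrite (bigD1 i) //= big1 => [|j ji].
  by rewrite addr0 => /eqP; rewrite mulf_eq0 expf_eq0 (negbTE (mu0 i)) andbF orbF => /eqP.
by rewrite Ej // hornerE mul0r.
Qed.

(** A product of the orders serves as common m, and the exponent absorbs repeated roots. *)
Lemma dvdp_unity_roots (rs : seq K) :
  (forall z, z \in rs -> exists2 m, (0 < m)%N & z ^+ m = 1) ->
  exists2 m, (0 < m)%N & \prod_(z <- rs) ('X - z%:P) %| ('X^m - 1) ^+ size rs.
Proof.
move=> hrs; have [m m0 hm] : exists2 m, (0 < m)%N & forall z, z \in rs -> z ^+ m = 1.
  elim: rs hrs => [|z rs IH] hrs; first by exists 1%N.
  have [|m m0 hm] := IH; first by move=> y hy; apply: hrs; rewrite inE hy orbT.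
  have [m' m0' hm'] := hrs z (mem_head _ _).
  exists (m * m')%N; first by rewrite muln_gt0 m0.
  move=> y; rewrite inE => /orP[/eqP ->|/hm e]; last by rewrite exprM e expr1n.
  by rewrite mulnC exprM hm' expr1n.
exists m => //; elim: rs hm {hrs} => [|z rs IH] hm; first by rewrite big_nil expr0 dvdpp.
rewrite big_cons exprS dvdp_mul ?IH // => [|y hy]; last by apply: hm; rewrite inE hy orbT.
by rewrite dvdp_XsubCl rootE hornerD hornerN hornerXn hornerC hm ?mem_head ?subrr.
Qed.

End PolynomialFacts.

(** * Shift operators and rationality *)

Section ShiftOperators.
Variables (K : numClosedFieldType) (M : nat).
Implicit Types (chi psi : {poly K}) (v : nat -> K).

(** The action on sequences of polynomials in the shift by M, represented by 'X. *)
Definition shift_op chi v (x : nat) : K := \sum_(j < size chi) chi`_j * v (x + M * j)%N.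

Lemma shift_op_wide n chi v x : (size chi <= n)%N ->
  shift_op chi v x = \sum_(j < n) chi`_j * v (x + M * j)%N.
Proof.
move=> sn; rewrite /shift_op (big_ord_widen n (fun j => chi`_j * v (x + M * j)%N)) //.
rewrite big_mkcond; apply: eq_bigr => j _; case: ltnP => // lj.
by rewrite nth_default ?mul0r.
Qed.

Lemma shift_opD chi psi v x : shift_op (chi + psi) v x = shift_op chi v x + shift_op psi v x.
Proof.
pose n := maxn (size chi) (size psi).
rewrite !(@shift_op_wide n) ?leq_maxl ?leq_maxr ?size_polyD // -big_split.
by apply: eq_bigr => j _; rewrite coefD mulrDl.
Qed.

Lemma shift_opC a v x : shift_op a%:P v x = a * v x.
Proof.
rewrite (@shift_op_wide 1) ?size_polyC_leq1 // big_ord1 coefC eqxx.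
by rewrite muln0 addn0.
Qed.

Lemma shift_opMX chi v x : shift_op (chi * 'X) v x = shift_op chi v (x + M)%N.
Proof.
rewrite (@shift_op_wide (size chi).+1); last first.
  by rewrite (leq_trans (size_polyMleq _ _)) // size_polyX addn2.
rewrite big_ord_recl coefMX mul0r add0r; apply: eq_bigr => j _.
by rewrite coefMX /= /bump /= add1n mulnS addnA.
Qed.

Lemma shift_opZ a chi v x : shift_op (a%:P * chi) v x = a * shift_op chi v x.
Proof.
rewrite (@shift_op_wide (size chi)) ?mul_polyC ?size_scale_leq // mulr_sumr.
by apply: eq_bigr => j _; rewrite coefZ mulrA.
Qed.

Lemma shift_opM chi psi v x : shift_op (chi * psi) v x = shift_op chi (shift_op psi v) x.
Proof.
elim/poly_ind: chi x => [|chi a IH] x.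
  by rewrite mul0r -[0 in LHS]polyC0 -[0 in RHS]polyC0 !shift_opC !mul0r.
rewrite mulrDl shift_opD shift_opZ mulrAC shift_opMX IH shift_opD shift_opC shift_opMX //.
Qed.

Lemma shift_op_subC chi a v x :
  shift_op (chi - a%:P) v x = shift_op chi v x - a * v x.
Proof. by rewrite -polyCN shift_opD shift_opC mulNr. Qed.

Lemma shift_opX v x : shift_op 'X v x = v (x + M)%N.
Proof. by rewrite -['X]mul1r shift_opMX -polyC1 shift_opC mul1r. Qed.

Lemma shift_opXn m v x : shift_op 'X^m v x = v (x + M * m)%N.
Proof.
elim: m x => [|m IH] x; first by rewrite expr0 -polyC1 shift_opC mul1r muln0 addn0.
by rewrite exprSr shift_opMX IH mulnS addnA.
Qed.

Lemma shift_op_ev0 c chi v : ev_mod c M (fun x => v x = 0) -> ev_mod c M (fun x => shift_op chi v x = 0).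
Proof.
move=> [n0 h]; exists n0 => x lx ex; apply: big1 => j _.
rewrite h ?mulr0 //; first by rewrite (leq_trans lx) ?leq_addr.
by rewrite addnC mulnC modnMDl.
Qed.

Lemma periodic_ev_const c n v : (0 < n)%N -> ev_mod c n (fun x => v (x + n)%N = v x) ->
  exists a, ev_mod c n (fun x => v x = a).
Proof.
move=> n_gt0 [n0 h]; pose x0 := (n0 * n + c)%N.
have e0 : x0 = c %[mod n] by rewrite modnMDl.
exists (v x0); exists x0 => x lx ex.
have /dvdnP[s es] : (n %| x - x0)%N by rewrite -eqn_mod_dvd // ex e0.
rewrite -(subnKC lx) es; elim: s {es} => [|s IH]; first by rewrite mul0n addn0.
rewrite mulSn [(n + _)%N]addnC addnA h ?IH //.
  by rewrite (leq_trans _ (leq_addr _ _)) // (leq_trans _ (leq_addr _ _)) // leq_pmulr.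
by rewrite addnC modnMDl.
Qed.

(** By induction 'X^m - 1 sends v to a polynomial on each class; once an antidifference of step M m
    is subtracted, v becomes periodic, hence constant on the class. *)
Lemma unipotent_polynomial c m B v : (0 < M)%N -> (0 < m)%N ->
  ev_mod c M (fun x => shift_op (('X^m - 1) ^+ B) v x = 0) ->
  forall c', c' = c %[mod M] ->
  exists u : {poly K}, ev_mod c' (M * m) (fun x => v x = u.[x%:R]).
Proof.
move=> M0 m0; elim: B v => [|B IH] v hv c' ec.
  exists 0; apply: ev_imp (ev_sub (dvdn_mulr m (dvdnn M)) ec hv) => x.
  by rewrite expr0 -polyC1 shift_opC mul1r hornerE.
have [|u hu] := IH (shift_op ('X^m - 1) v) _ c' ec.
  by apply: ev_imp hv => x; rewrite exprSr shift_opM.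
have Mm : (0 < M * m)%N by rewrite muln_gt0 M0.
have [U hU] := antidifference u Mm.
have [a ha] : exists a, ev_mod c' (M * m) (fun x => v x - U.[x%:R] = a).
  apply: periodic_ev_const => //; apply: ev_imp hu => x.
  rewrite -polyC1 shift_op_subC shift_opXn mul1r -hU hornerD hornerN shiftp_evaln => /eqP.
  by rewrite subr_eq => /eqP ->; ring.
exists (U + a%:P); apply: ev_imp ha => x <-.
by rewrite hornerD hornerC addrC subrK.
Qed.

End ShiftOperators.

(** * Rationality of the regularised sequence *)

Section Rationality.
Variables (K : numClosedFieldType) (f : nat -> K).
Hypothesis f_mult : multiplicative_fun f.
Variables (c M r : nat) (J : 'I_r -> nat).
Hypotheses (M_gt0 : (0 < M)%N) (genJ : gen f c M J) (indJ : indep f c M J).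
Variables (l e Jb : nat).
Let q := (l ^ e)%N.
Hypotheses (l_prime : prime l) (e_gt0 : (0 < e)%N) (Ml : coprime M l).
Hypotheses (q1 : q = 1 %[mod M]) (fq : f q != 0).
Hypotheses (J_lt : forall i, (J i < Jb)%N) (Jb_lt : (M + Jb.+2 < l)%N).
Variables (R : nat) (pl pr : {poly K}).
Hypotheses (pl0 : pl != 0) (pr0 : pr != 0).
Hypothesis poles : forall k, exists u : 'I_R -> {poly K}, ev_mod c M (fun x =>
  pl.[x%:R] * (pr.[(x + k)%:R] * f (x + k)%N) = \sum_i (u i).[x%:R] * f (x + i)%N).
Variable h : nat.
Hypothesis heights : forall k, height f c M J k (h * (1 + trunc_log 2 k)).

(** The factor removes the poles that move with a; by [poles], the remaining denominator is the
    fixed [pl]. *)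
Definition regularized a (x : nat) := pr.[(x + a)%:R] * f (x + a)%N.

(** The hypothesis [poles] makes the coordinates polynomial over a denominator common to all k. They
    are unique by [indJ], so comparison with [heights] bounds their degrees. *)
Lemma regularized_coords : exists2 B : {poly K}, B != 0 & exists C, forall k,
  exists w : 'I_r -> {poly K}, (forall i, (size (w i) <= C + h * (1 + trunc_log 2 k))%N) /\
  ev_mod c M (fun x => B.[x%:R] * regularized k x = \sum_i (w i).[x%:R] * f (x + J i)%N).
Proof.
have [D D0 [w Ew]] : exists2 D : {poly K}, D != 0 & exists w : 'I_R -> 'I_r -> {poly K},
    forall i : 'I_R, ev_mod c M (fun x => D.[x%:R] * f (x + i)%N = \sum_j (w i j).[x%:R] * f (x + J j)%N).
  exact: (common_denominator (fun i : 'I_R => genJ i)).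
exists (D * pl); first exact: mulf_neq0.
exists (size D + size pl + size pr)%N => k.
have [U EU] := poles k; have [Dk Dk0 [u [sDk su Eu]]] := heights k.
pose W j := \sum_i U i * w i j.
have EW : ev_mod c M (fun x => (D * pl).[x%:R] * regularized k x = \sum_j (W j).[x%:R] * f (x + J j)%N).
  apply: ev_imp (ev_and EU (ev_all Ew)) => x [EUx Ewx].
  rewrite hornerM -mulrA EUx mulr_sumr.
  under [RHS]eq_bigr => j _ do rewrite horner_sum mulr_suml.
  rewrite exchange_big; apply: eq_bigr => i _ /=.
  rewrite mulrCA Ewx mulr_sumr; apply: eq_bigr => j _.
  by rewrite hornerM mulrA.
exists W; split=> // j.
have eW : Dk * W j = D * pl * shiftp k pr * u j.
  apply/eqP; rewrite -subr_eq0; apply/eqP.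
  apply: (indJ (u := fun j => Dk * W j - D * pl * shiftp k pr * u j) M_gt0 (dvdnn M) erefl).
  apply: ev_imp (ev_and EW Eu) => x [Ex1 Ex2].
  transitivity (Dk.[x%:R] * (\sum_j (W j).[x%:R] * f (x + J j)%N) -
     (D * pl * shiftp k pr).[x%:R] * \sum_j (u j).[x%:R] * f (x + J j)%N).
    rewrite !mulr_sumr -sumrB; apply: eq_bigr => i _.
    by rewrite hornerD hornerN !hornerM; ring.
  by rewrite -Ex1 -Ex2 /regularized !hornerM shiftp_evaln; ring.
have [->|W0] := eqVneq (W j) 0; first by rewrite size_poly0.
apply: (@leq_trans (size (Dk * W j))).
  by rewrite size_mul // -(prednK (n := size Dk)) ?size_poly_gt0 // addSn leq_addl.
have sM (p p' : {poly K}) : (size (p * p')%R <= size p + size p')%N.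
  by rewrite (leq_trans (size_polyMleq _ _)) ?leq_pred.
rewrite eW; apply: leq_trans (sM _ _) _; rewrite leq_add //.
apply: leq_trans (sM _ _) _; rewrite size_shiftp leq_add2r.
exact: sM.
Qed.

(** The coordinates of the N shifts by M t, t < N, lie in a space of dimension O(log N), below N for
    a suitable N. A dependence over the constants is a recurrence with constant coefficients. *)
Lemma regularized_cfinite a : exists2 chi : {poly K}, chi != 0 &
  ev_mod c M (fun x => shift_op M chi (regularized a) x = 0).
Proof.
have [B B0 [C hC]] := regularized_coords.
have [N hN] := log_lt_linear (r * (C + h)) M a.
pose S := (C + h * (1 + trunc_log 2 (M * N + a)))%N.
have /choice[w hw] (t : 'I_N) : exists w : 'I_r -> {poly K}, (forall i, (size (w i) <= S)%N) /\
    ev_mod c M (fun x => B.[x%:R] * regularized (a + M * t) x = \sum_i (w i).[x%:R] * f (x + J i)%N).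
  have [w [sw E]] := hC (a + M * t)%N; exists w; split=> // i.
  apply: leq_trans (sw i) _; rewrite leq_add2l leq_mul2l leq_add2l leq_trunc_log ?orbT //.
  by rewrite addnC leq_add2r leq_mul2l ltnW ?orbT.
have rS : (r * S < #|'I_N|)%N.
  rewrite card_ord; apply: leq_ltn_trans hN; rewrite -mulnA leq_mul2l; apply/orP; right.
  by rewrite mulnDl leq_add2r leq_pmulr.
have [b [t0 bt0] hb] := poly_dep rS (fun t => (hw t).1).
pose chi := \poly_(j < N) (if insub j is Some t then b t else 0).
have chiE (t : 'I_N) : chi`_t = b t.
  by rewrite coef_poly ltn_ord valK.
exists chi; first by apply: contraNneq bt0 => chi0; rewrite -chiE chi0 coef0.
have E : ev_mod c M (fun x => forall t : 'I_N, B.[x%:R] * regularized (a + M * t) x =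
    \sum_i (w t i).[x%:R] * f (x + J i)%N).
  by apply: ev_all => t; exact: (hw t).2.
apply: ev_imp (ev_and E (poly_ev_neq0 c M B0)) => x [Ex Bx].
apply: (mulfI Bx); rewrite mulr0 (@shift_op_wide _ _ N) ?size_poly // mulr_sumr.
transitivity (\sum_(t < N) b t * \sum_i (w t i).[x%:R] * f (x + J i)%N).
  apply: eq_bigr => t _; rewrite chiE -Ex mulrCA /regularized.
  by rewrite (addnC a) addnA.
under eq_bigr => t _ do rewrite mulr_sumr.
rewrite exchange_big; apply: big1 => i _ /=.
transitivity ((\sum_t b t *: w t i).[x%:R] * f (x + J i)%N).
  by rewrite horner_sum mulr_suml; apply: eq_bigr => t _; rewrite hornerZ mulrA.
by rewrite hb hornerE mul0r.
Qed.

Implicit Types (D : {poly K}) (phi : seq ({poly K} * nat)) (lam : K).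

(** Its vanishing says that [lform f phi] divided by D is geometric of ratio lam under the shift by
    m. *)
Definition ratio_form D m (phi : seq ({poly K} * nat)) lam :=
  [seq (D * shiftp m p.1, (m + p.2)%N) | p <- phi] ++
  [seq (- lam%:P * shiftp m D * p.1, p.2) | p <- phi].

Lemma lform_ratio_form D m phi lam x : lform f (ratio_form D m phi lam) x =
  D.[x%:R] * lform f phi (x + m)%N - lam * D.[(x + m)%:R] * lform f phi x.
Proof.
rewrite lform_cat /lform !big_map !mulr_sumr -sumrN; congr (_ + _); apply: eq_bigr => p _ /=.
  by rewrite hornerM shiftp_evaln mulrA addnA.
by rewrite !hornerM hornerN hornerC shiftp_evaln; ring.
Qed.

Lemma dilp_shiftp m (p : {poly K}) : dilp q (shiftp m p) = shiftp (q * m) (dilp q p).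
Proof.
have q0 : q%:R != 0 :> K by rewrite pnatr_eq0 -lt0n q_gt0.
rewrite /dilp /shiftp -!comp_polyA; congr (_ \Po _).
rewrite comp_polyD comp_polyX comp_polyC comp_polyZ comp_polyX scalerDr natrM.
by rewrite -mul_polyC [X in _ = _ + X]scale_polyC mulKf.
Qed.

(** Dilation multiplies the step by q and keeps the ratio, so one eigenvector yields others with
    steps q^n M. *)
Lemma dilate_ratio_form D m phi lam : dilate_form l e (ratio_form D m phi lam) =
  ratio_form (dilp q D) (q * m) (dilate_form l e phi) lam.
Proof.
rewrite /dilate_form /ratio_form map_cat -!map_comp; congr (_ ++ _); apply: eq_map => p /=.
  by rewrite -/q [dilp q (_ * _)]comp_polyM -/(dilp q _) -/(dilp q (shiftp _ _)) dilp_shiftp mulnDr.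
rewrite -/q [dilp q (_ * _)]comp_polyM [(- _ * shiftp m D) \Po _]comp_polyM -/(dilp q (shiftp m D)) dilp_shiftp.
by rewrite -polyCN comp_polyC.
Qed.

(** After one dilation all shifts are multiples of l, so b = 1 serves and the transfer can be
    iterated. *)
Lemma good_shifts_dilate phi : good_shifts l (dilate_form l e phi).
Proof.
exists 1%N => p /mapP[p' _ ->] /=.
have lq : (l %| l ^ e * p'.2)%N by rewrite dvdn_mulr // dvdn_exp.
by rewrite dvdn_addl // dvdn1 neq_ltn prime_gt1 ?orbT.
Qed.

Lemma transfer_iter phi n : good_shifts l phi ->
  ev_mod c M (fun x => lform f phi x = 0) -> ev_mod c M (fun x => lform f (iter n (dilate_form l e) phi) x = 0).
Proof.
move=> g E; elim: n => // n IH.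
apply: (transfer f_mult M_gt0 genJ indJ) => //.
by case: n {IH} => // n; exact: good_shifts_dilate.
Qed.

Lemma transfer_iter_inv phi n : good_shifts l phi ->
  ev_mod c M (fun x => lform f (iter n (dilate_form l e) phi) x = 0) -> ev_mod c M (fun x => lform f phi x = 0).
Proof.
move=> g; elim: n => // n IH E; apply: IH.
apply: (transfer_inv f_mult M_gt0 genJ indJ) E => //.
by case: n => // n; exact: good_shifts_dilate.
Qed.

(* The W_n := lform (iter n dilate_form phi) lie in a space of dimension r, and
   W_n / D(x / q^n) is geometric of ratio lam along steps of length q^n M; so
   two of W_0, ..., W_r have the same ratio along steps of length q^r M. *)
Lemma geometric_ratio_unity D lam (u : 'I_r -> {poly K}) :
  let phi := [seq (u i, J i) | i <- index_enum 'I_r] in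
  D != 0 -> lam != 0 ->
  ev_mod c M (fun x => D.[x%:R] * lform f phi (x + M)%N = lam * D.[(x + M)%:R] * lform f phi x) ->
  ~ ev_mod c M (fun x => lform f phi x = 0) ->
  exists2 m, (0 < m)%N & lam ^+ m = 1.
Proof.
move=> phi D0 lam0 geo nz.
have q0 : (0 < q)%N := q_gt0 e l_prime.
have q_gt1 : (1 < q)%N by rewrite -(exp1n e) ltn_exp2r // prime_gt1.
pose W n := lform f (iter n (dilate_form l e) phi); pose Dn n := iter n (dilp q) D.
have Dn0 n : Dn n != 0 by elim: n => //= n IH; rewrite dilp_eq0.
have gphi : good_shifts l phi.
  exists 1%N => p /mapP[i _ ->]; apply/negP => /dvdn_leq; have := J_lt i; rewrite /=; lia.
have Wnz n : ~ ev_mod c M (fun x => W n x = 0) by move/(transfer_iter_inv gphi).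
have ratioE n : iter n (dilate_form l e) (ratio_form D M phi lam) =
    ratio_form (Dn n) (q ^ n * M) (iter n (dilate_form l e) phi) lam.
  elim: n => [|n IH]; first by rewrite mul1n.
  by rewrite !iterS IH dilate_ratio_form expnS mulnA.
have geon n : ev_mod c M (fun x => (Dn n).[x%:R] * W n (x + q ^ n * M)%N =
    lam * (Dn n).[(x + q ^ n * M)%:R] * W n x).
  have : ev_mod c M (fun x => lform f (iter n (dilate_form l e) (ratio_form D M phi lam)) x = 0).
    apply: transfer_iter.
      exists 1%N => p; rewrite mem_cat => /orP[] /mapP[p' /mapP[i _ ->] ->] /=;
      by apply/negP => /dvdn_leq; have := J_lt i; lia.
    by apply: ev_imp geo => x; rewrite lform_ratio_form => ->; rewrite subrr.
  by apply: ev_imp => x; rewrite ratioE lform_ratio_form => /eqP; rewrite subr_eq0 => /eqP.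
have [B B0 [U EU]] := common_denominator (fun n : 'I_r.+1 =>
  spanned_lform nonzeroM (fun p (_ : p \in iter n (dilate_form l e) phi) => genJ p.2)).
(* With this T the (r + 1) T unknown coefficients outnumber the r (T + S) equations. *)
pose S := \max_n \max_i size (U n i); pose T := (r * S).+1.
have [b [na bna] hb] : exists2 b : 'I_r.+1 * 'I_T -> K, (exists i, b i != 0) &
    forall j, \sum_i b i *: ('X^(i.2) * U i.1 j) = 0.
  apply: (@poly_dep _ _ r (T + S)%N); first by rewrite card_prod !card_ord mulnDr mulSn addnC ltn_add2r.
  move=> [n a] j /=; rewrite (leq_trans (size_polyMleq _ _)) // size_polyXn addSn /=.
  apply: leq_add; first by rewrite ltnW.
  apply: leq_trans (@leq_bigmax _ (fun n => \max_i size (U n i)) n).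
  exact: (@leq_bigmax _ (fun i => size (U n i))).
pose E n := \poly_(a < T) (if insub a is Some a then b (n, a) else 0).
have EE n : E n = \sum_a b (n, a) *: 'X^a.
  by rewrite /E poly_def; apply: eq_bigr => a _; rewrite valK.
have E0 j : \sum_n E n * U n j = 0.
  transitivity (\sum_p b (p.1, p.2) *: ('X^(p.2) * U p.1 j)); last first.
    by rewrite -[RHS](hb j); apply: eq_bigr => -[n a].
  rewrite -(pair_bigA _ (fun n (a : 'I_T) => b (n, a) *: ('X^a * U n j))) /=.
  by apply: eq_bigr => n _; rewrite EE mulr_suml; apply: eq_bigr => a _; rewrite scalerAl.
have EW : ev_mod c M (fun x => \sum_n (E n).[x%:R] * W n x = 0).
  apply: ev_imp (ev_and (poly_ev_neq0 c M B0) (ev_all EU)) => x [Bx EUx].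
  apply: (mulfI Bx); rewrite mulr0 mulr_sumr.
  transitivity (\sum_n (E n).[x%:R] * \sum_i (U n i).[x%:R] * f (x + J i)%N).
    by apply: eq_bigr => n _; rewrite -EUx mulrCA.
  under eq_bigr => n _ do rewrite mulr_sumr.
  rewrite exchange_big; apply: big1 => i _ /=.
  transitivity ((\sum_n E n * U n i).[x%:R] * f (x + J i)%N); last by rewrite E0 hornerE mul0r.
  by rewrite horner_sum mulr_suml; apply: eq_bigr => n _; rewrite hornerM mulrA.
have Q : ev_mod c M (fun x => \sum_n (E n).[x%:R] * W n x = 0 /\
    forall n : 'I_r.+1, (Dn n).[x%:R] != 0 /\
    (Dn n).[x%:R] * W n (x + q ^ n * M)%N = lam * (Dn n).[(x + q ^ n * M)%:R] * W n x).
  apply: (ev_and EW); apply: ev_all => n.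
  by apply: ev_and (geon n); exact: poly_ev_neq0.
have [n0 hQ] := Q; pose x0 := (n0 * M + c)%N.
pose N := (q ^ r * M)%N; have N0 : (0 < N)%N by rewrite muln_gt0 expn_gt0 q0.
have inQ t x : (M %| t)%N -> x = (x0 + t)%N -> (n0 <= x)%N /\ x = c %[mod M].
  move=> Mt ->; split; first by rewrite /x0 -addnA (leq_trans _ (leq_addr _ _)) // leq_pmulr.
  by rewrite -modnDmr (eqP Mt) addn0 modnMDl.
have Wgeo (n : 'I_r.+1) s : (Dn n).[x0%:R] * W n (x0 + s * (q ^ n * M))%N =
    lam ^+ s * (Dn n).[(x0 + s * (q ^ n * M))%:R] * W n x0.
  elim: s => [|s IH]; first by rewrite addn0 mul1r.
  set y := (x0 + s * _)%N in IH *.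
  have -> : (x0 + s.+1 * (q ^ n * M) = y + q ^ n * M)%N by rewrite mulSn addnCA addnC.
  have [ly ey] : (n0 <= y)%N /\ y = c %[mod M] by apply: inQ erefl; rewrite !dvdn_mull.
  have [_ /(_ n)[Dy Wy]] := hQ y ly ey.
  apply: (mulfI Dy); rewrite mulrCA Wy exprS.
  transitivity (lam * (Dn n).[(y + q ^ n * M)%:R] * ((Dn n).[x0%:R] * W n y)); first by ring.
  by rewrite IH; ring.
pose mu (n : 'I_r.+1) := lam ^+ (q ^ (r - n)).
have Wmu (n : 'I_r.+1) t : (Dn n).[x0%:R] * W n (x0 + N * t)%N =
    mu n ^+ t * (Dn n).[(x0 + N * t)%:R] * W n x0.
  have -> : (N * t = q ^ (r - n) * t * (q ^ n * M))%N.
    rewrite /N -{1}(subnK (ltn_ord n : n <= r)%N) expnD -!mulnA; congr (_ * _)%N.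
    by rewrite mulnA mulnC.
  by rewrite Wgeo exprM.
have Dx0 (n : 'I_r.+1) : (Dn n).[x0%:R] != 0.
  by have [|l0 e0] := @inQ 0%N x0 _ (esym (addn0 _)) => //; have [_ /(_ n)[]] := hQ x0 l0 e0.
(* A zero at [x0] would spread along x0 mod N, and then to the whole class by [lform_extend]. *)
have Wx0 (n : 'I_r.+1) : W n x0 != 0.
  apply/eqP => W0; apply: (Wnz n).
  apply: (lform_extend genJ indJ (phi := iter n (dilate_form l e) phi) (c' := x0) N0).
  - exact: dvdn_mull.
  - by rewrite modnMDl.
  exists x0 => x lx ex; have /dvdnP[s es] : (N %| x - x0)%N by rewrite -eqn_mod_dvd // ex.
  apply: (mulfI (Dx0 n)); rewrite mulr0 -/(W n x) -(subnKC lx) es [(s * N)%N]mulnC Wmu W0.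
  by rewrite mulr0.
(* Distinct ratios would force every [E n] to be 0 by [exp_poly_indep], against the nonzero
   coefficient [b na]. *)
have [mu_inj|] := EM (injective mu).
  pose F (n : 'I_r.+1) := ((E n * Dn n) \Po (N%:R *: 'X + x0%:R%:P)) * (W n x0 / (Dn n).[x0%:R])%:P.
  have F0 : forall n : 'I_r.+1, F n = 0.
    apply: (exp_poly_indep mu_inj) => [n|t]; first by rewrite expf_neq0.
    have [lx ex] : (n0 <= x0 + N * t)%N /\ (x0 + N * t)%N = c %[mod M].
      by apply: inQ erefl; rewrite -mulnA dvdn_mull ?dvdn_mulr.
    have [SW _] := hQ _ lx ex; rewrite -[RHS]SW; apply: eq_bigr => n _.
    rewrite /F hornerM hornerC horner_comp hornerD hornerZ hornerX hornerC -natrM -natrD addnC hornerM.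
    apply: (mulfI (Dx0 n)); rewrite [RHS]mulrCA Wmu.
    by field; exact: Dx0.
  case: na bna => n a /=; have -> : b (n, a) = (E n)`_a by rewrite coef_poly ltn_ord valK.
  suff -> : E n = 0 by rewrite coef0 eqxx.
  have := F0 n => /eqP; rewrite mulf_eq0 polyC_eq0 mulf_eq0 invr_eq0.
  rewrite (negbTE (Wx0 n)) (negbTE (Dx0 n)) !orbF -size_poly_eq0 size_comp_poly2; last first.
    have sN : size (N%:R *: 'X : {poly K}) = 2.
      by rewrite size_scale ?size_polyX // pnatr_eq0 -lt0n.
    by rewrite size_polyDl sN // (leq_ltn_trans (size_polyC_leq1 _)).
  by rewrite size_poly_eq0 mulf_eq0 (negbTE (Dn0 n)) orbF => /eqP.
move=> ninj.
have [n1 [n2 [n12 e12]]] : exists n1 n2 : 'I_r.+1, (n1 < n2)%N /\ mu n1 = mu n2.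
  apply: contrapT => no; apply: ninj => n1 n2 e12; apply: val_inj.
  case: (ltngtP n1 n2) => // lt; case: no; first by exists n1, n2.
  by exists n2, n1.
have lt12 : (q ^ (r - n2) < q ^ (r - n1))%N.
  rewrite ltn_exp2l // ltn_sub2l // (leq_trans n12) //.
  by rewrite -ltnS ltn_ord.
exists (q ^ (r - n1) - q ^ (r - n2))%N; first by rewrite subn_gt0.
apply: (mulIf (expf_neq0 (q ^ (r - n2)) lam0)).
by rewrite -exprD subnK ?mul1r // ltnW.
Qed.

(** Let chi be an annihilator of least degree and z a root. Applying chi / (X - z) gives a nonzero
    eigenvector of eigenvalue z, so z is a root of unity; hence chi divides a power of some X^m -
    1. *)
Lemma regularized_rational a : exists2 m, (0 < m)%N & forall c', c' = c %[mod M] ->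
  exists u : {poly K}, ev_mod c' (M * m) (fun x => regularized a x = u.[x%:R]).
Proof.
pose ann (chi : {poly K}) := ev_mod c M (fun x => shift_op M chi (regularized a) x = 0).
have [chi [chi0 hchi min_chi]] : exists chi : {poly K}, [/\ chi != 0, ann chi &
    forall psi : {poly K}, psi != 0 -> (size psi < size chi)%N -> ~ ann psi].
  have [chi chi0 hchi] := regularized_cfinite a; have [n] := ubnP (size chi).
  elim: n chi chi0 hchi => // n IH chi chi0 hchi; rewrite ltnS => sn.
  have [[psi [psi0 [spsi hpsi]]]|no] := EM (exists psi : {poly K}, psi != 0 /\
      (size psi < size chi)%N /\ ann psi).
    by apply: (IH psi psi0 hpsi); exact: leq_trans sn.
  by exists chi; split=> // psi psi0 sp hp; apply: no; exists psi.
have [rs Ers] := closed_field_poly_normal chi.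
have unity z : z \in rs -> exists2 m, (0 < m)%N & z ^+ m = 1.
  move=> zrs; have : root chi z by rewrite Ers rootZ ?lead_coef_eq0 // root_prod_XsubC.
  move/factor_theorem => [psi Epsi]; pose w := shift_op M psi (regularized a).
  have psi0 : psi != 0 by apply: contraNneq chi0 => p0; rewrite Epsi p0 mul0r.
  have w_nz : ~ ev_mod c M (fun x => w x = 0).
    by apply: min_chi => //; rewrite Epsi size_Mmonic ?monicXsubC // size_XsubC addn2.
  have w_geo : ev_mod c M (fun x => w (x + M)%N = z * w x).
    apply: ev_imp hchi => x; rewrite Epsi mulrC shift_opM shift_op_subC shift_opX => /eqP.
    by rewrite subr_eq0 => /eqP.
  (* An eigenvalue 0 would make w vanish after one shift, against the minimality of chi. *)
  have z0 : z != 0.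
    apply/eqP => z0; apply: w_nz; apply: (ev_unshift (dvdnn M)).
    by apply: ev_imp w_geo => x ->; rewrite z0 mul0r.
  have [D D0 [u Eu]] : spanned f nonzero c M J w.
    apply: (@spanned_ext _ _ _ _ _ _ _
      (lform f [seq (psi`_j *: shiftp (a + M * j) pr, (a + M * j)%N) | j : 'I_(size psi) <- index_enum _])).
      apply: ev_true => x; rewrite /lform big_map; apply: eq_bigr => j _ /=.
      by rewrite hornerZ shiftp_evaln -mulrA /regularized addnAC -addnA.
    by apply: (spanned_lform nonzeroM) => p _; exact: genJ.
  pose phi := [seq (u i, J i) | i <- index_enum 'I_r].
  have Ephi : ev_mod c M (fun x => D.[x%:R] * w x = lform f phi x).
    by apply: ev_imp Eu => x ->; rewrite /lform big_map.
  apply: (@geometric_ratio_unity D z u) => //.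
    apply: ev_imp (ev_and w_geo (ev_and Ephi (ev_shift (dvdnn M) Ephi))) => x [Ex [<- <-]].
    by rewrite Ex; ring.
  move=> E0; apply: w_nz; apply: ev_imp (ev_and E0 (ev_and Ephi (poly_ev_neq0 c M D0))).
  by move=> x [Ex [Ex' Dx]]; apply: (mulfI Dx); rewrite Ex' mulr0.
have [m m0 dvd] := dvdp_unity_roots unity; exists m => //.
apply: (unipotent_polynomial (B := size rs)) => //.
have /dvdpP[psi ->] : chi %| ('X^m - 1) ^+ size rs.
  by rewrite Ers dvdpZl // lead_coef_eq0.
by apply: ev_imp (shift_op_ev0 psi hchi) => x; rewrite shift_opM.
Qed.

End Rationality.

(** * From D-finiteness to quasi-rationality *)

Section Recurrence.
Variable K : numClosedFieldType.

(** The rising factorial (X + 1) ... (X + i), the factor that i derivations put on a coefficient. *)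
Fixpoint rising i : {poly K} := if i is i'.+1 then shiftp 1 (rising i') * ('X + 1%:P) else 1.

Lemma fps_derivnE i (A : fps K) k : fps_derivn i A k = (rising i).[k%:R] * A (k + i)%N.
Proof.
elim: i k => [|i IH] k; first by rewrite hornerE mul1r addn0.
rewrite /fps_derivn iterS -/(fps_derivn i A) /fps_deriv IH /= hornerM shiftp_evaln.
by rewrite addn1 hornerD hornerX hornerC natr1 addSnnS mulrAC mulr_natr.
Qed.

Lemma rising_monic i : rising i \is monic.
Proof.
elim: i => [|i IH]; first exact: monic1.
by rewrite /= monicMl ?monicXaddC // monicE lead_coef_shiftp -monicE.
Qed.

Lemma size_rising i : size (rising i) = i.+1.
Proof.
elim: i => [|i IH]; first by rewrite size_poly1.
by rewrite /= size_Mmonic ?monicXaddC ?size_XaddC ?size_shiftp ?IH ?addn2 // shiftp_eq0 monic_neq0 ?rising_monic.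
Qed.

(** A zero top coefficient is dropped; a zero bottom one is removed by replacing x with x - 1. *)
Lemma trim_recurrence (f : nat -> K) T (P : nat -> {poly K}) n0 :
  (exists2 t, (t < T)%N & P t != 0) ->
  (forall x, (n0 <= x)%N -> \sum_(t < T) (P t).[x%:R] * f (x + t)%N = 0) ->
  exists R (P' : nat -> {poly K}) n1, [/\ P' 0%N != 0, P' R != 0 &
    forall x, (n1 <= x)%N -> \sum_(t < R.+1) (P' t).[x%:R] * f (x + t)%N = 0].
Proof.
elim: T P n0 => [|T IH] P n0 [t tT Pt] h; first by [].
have [PT|PT] := eqVneq (P T) 0.
  apply: (IH P n0) => [|x lx].
    exists t => //; move: tT; rewrite ltnS leq_eqVlt => /orP[/eqP tT|//].
    by rewrite tT PT eqxx in Pt.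
  by have := h x lx; rewrite big_ord_recr /= PT hornerE mul0r addr0.
have [P0|P0] := eqVneq (P 0%N) 0; last by exists T, P, n0.
apply: (IH (fun t => P t.+1 \Po ('X - 1%:P)) n0.+1) => [|x lx].
  case: t tT Pt => [|t] tT Pt; first by rewrite P0 eqxx in Pt.
  by exists t => //; rewrite -size_poly_eq0 size_comp_poly2 ?size_XsubC // size_poly_eq0.
have x0 : (0 < x)%N by exact: leq_trans lx.
have := h x.-1; rewrite -ltnS prednK // lx => /(_ isT).
rewrite big_ord_recl P0 hornerE mul0r add0r => E; rewrite -[RHS]E; apply: eq_bigr => i _.
rewrite horner_comp hornerXsubC /= /bump /= add1n -addSnnS prednK //.
by rewrite -{1}(prednK x0) -natr1 addrK.
Qed.

Lemma D_finite_recurrence (f : nat -> K) : D_finite (gen_series f) ->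
  exists R (P : nat -> {poly K}) n0, [/\ P 0%N != 0, P R != 0 &
    forall x, (n0 <= x)%N -> \sum_(t < R.+1) (P t).[x%:R] * f (x + t)%N = 0].
Proof.
move=> [m [Q [[i0 Qi0] h]]]; pose s := \max_i size (Q i).
have sQ i : (size (Q i) <= s)%N by exact: (@leq_bigmax _ (fun i => size (Q i))).
pose P (t : nat) : {poly K} := \sum_(i < m.+1) \sum_(j < s | (s - j + i == t)%N)
  (Q i)`_j *: shiftp (s - j) (rising i).
apply: (@trim_recurrence f (s + m).+1 P 1%N) => [|x x0].
  (* For this largest i and j = deg Q_i, the coefficient of X^i in P_(s - j + i) is the leading
     coefficient of Q_i, since [rising i'] has degree i' < i for the other terms. *)
  have [i Qi imax] : exists2 i, Q i != 0 & forall i', Q i' != 0 -> (i' <= i)%N.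
    by case: (@arg_maxnP _ i0 (fun i => Q i != 0) (fun i => i : nat) Qi0) => i ? ?; exists i.
  have sQi : (0 < size (Q i))%N by rewrite size_poly_gt0.
  have js : ((size (Q i)).-1 < s)%N by rewrite prednK.
  exists (s - (size (Q i)).-1 + i)%N.
    by rewrite ltnS leq_add ?leq_subr // -ltnS.
  apply/eqP => /(congr1 (fun p : {poly K} => p`_i)); rewrite coef0 coef_sum.
  rewrite (bigD1 i) //= [X in _ + X]big1 ?addr0 => [|i' i'i].
    rewrite coef_sum (bigD1 (Ordinal js)) //= [X in _ + X]big1 ?addr0 => [|j /andP[/eqP ej nj]].
      rewrite coefZ -lead_coefE; have -> : (shiftp (s - (size (Q i)).-1) (rising i))`_i = 1.
        have /monicP <- : shiftp (s - (size (Q i)).-1) (rising i) \is monic.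
          by rewrite monicE lead_coef_shiftp -monicE rising_monic.
        by rewrite lead_coefE size_shiftp size_rising.
      by move/eqP; rewrite mulr1 lead_coef_eq0 (negbTE Qi).
    case/eqP: nj; apply: val_inj => /=; have := ltn_ord j; move: ej js; lia.
  rewrite coef_sum big1 // => j _; rewrite coefZ.
  have [Qi'|/imax li] := eqVneq (Q i') 0; first by rewrite Qi' coef0 mul0r.
  rewrite [X in _ * X]nth_default ?mulr0 // size_shiftp size_rising.
  by rewrite ltn_neqAle li andbT.
(* The coefficient of z^(x + s) is read off: s bounds the sizes of all Q_i, so the arguments of f
   are at least x > 0 and the constant term of the series does not occur. *)
have := h (x + s)%N => E; rewrite -[RHS]E.
transitivity (\sum_(t < (s + m).+1) \sum_(i < m.+1) \sum_(j < s | (s - j + i == t)%N)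
    (Q i)`_j * ((rising i).[(x + (s - j))%:R] * f (x + (s - j + i))%N)).
  apply: eq_bigr => t _; rewrite horner_sum mulr_suml; apply: eq_bigr => i _.
  rewrite horner_sum mulr_suml; apply: eq_bigr => j /eqP ej.
  by rewrite hornerZ shiftp_evaln ej mulrA.
rewrite exchange_big; apply: eq_bigr => i _ /=.
pose G (j : nat) := (Q i)`_j * ((rising i).[(x + (s - j))%:R] * f (x + (s - j + i))%N).
transitivity (\sum_(j < s) G j).
  rewrite (exchange_big_dep predT) //=; apply: eq_bigr => j _.
  have lt : (s - j + i < (s + m).+1)%N by rewrite ltnS leq_add ?leq_subr // -ltnS.
  by rewrite (big_pred1 (Ordinal lt)) // => t; rewrite /= eq_sym.
rewrite (big_ord_widen (x + s).+1 G) ?leqW ?leq_addl //.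
rewrite /fps_mul /fps_of_poly big_mkcond; apply: eq_bigr => j _ /=.
case: ltnP => lj; last by rewrite (nth_default _ (leq_trans (sQ i) lj)) mul0r.
rewrite /G fps_derivnE -addnBA ?(ltnW lj) // /gen_series addnA; congr (_ * (_ * _)).
by rewrite !addn_eq0 eqn0Ngt x0.
Qed.

End Recurrence.

Definition quasi_rational (K : numClosedFieldType) (f : nat -> K) : Prop :=
  exists2 N, (0 < N)%N & forall d, exists2 p : {poly K}, p != 0 &
    exists u : {poly K}, ev_mod d N (fun x => p.[x%:R] * f x = u.[x%:R]).

(** The class c mod M comes first, then l, depending on M and [J], then the height and pole bounds.
    Rationality is obtained for f (x + a) on that one class, and a < M reaches all classes modulo
    M. *)
Lemma recurrence_quasi_rational (K : numClosedFieldType) (f : nat -> K) R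
  (P : nat -> {poly K}) n0 : multiplicative_fun f -> P 0%N != 0 -> P R != 0 ->
  (forall x, (n0 <= x)%N -> \sum_(t < R.+1) (P t).[x%:R] * f (x + t)%N = 0) ->
  ~ eventually_zero f -> quasi_rational f.
Proof.
move=> f_mult P0 PR rec nz.
have R_gt0 : (0 < R)%N.
  rewrite lt0n; apply/eqP => R0; apply: nz.
  by apply: (@window_eventually_zero _ _ _ _ _ 1 0 PR rec) => // t i; rewrite R0.
have genR := gen_recurrence PR rec.
have [c [M [r [J [M_gt0 genJ indJ]]]]] := gen_indep (ltn0Sn 0) genR.
pose Jb := (\max_i J i).+1.
have J_lt i : (J i < Jb)%N by rewrite ltnS; exact: leq_bigmax.
pose e := totient M; have e_gt0 : (0 < e)%N by rewrite totient_gt0.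
have [l [l_prime]] := exists_prime_power_neq0 f_mult PR rec nz (M + Jb.+2) e_gt0.
move=> Jb_lt fq.
have Ml : coprime M l.
  rewrite coprime_sym prime_coprime //; apply/negP => /dvdn_leq; lia.
have q1 : (l ^ e)%N = 1 %[mod M] by apply: Euler_exp_totient; rewrite coprime_sym.
have Jb_lt' : (Jb.+2 < l)%N by exact: leq_ltn_trans (leq_addl _ _) Jb_lt.
have [h Hh] := height_log f_mult M_gt0 genJ indJ l_prime e_gt0 Ml q1 fq J_lt Jb_lt'.
have genW : gen f c M (fun i : 'I_R => i : nat).
  by apply: gen_sub genR => //; rewrite ?dvd1n ?modn1.
have few : exists h, forall k, exists2 D : {poly K}, D != 0 &
  (size D <= h * (1 + trunc_log 2 k))%N /\ exists u : 'I_R -> {poly K},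
  ev_mod c M (fun x => D.[x%:R] * f (x + k)%N = \sum_i (u i).[x%:R] * f (x + i)%N).
  have [B B0 [v Ev]] := common_denominator (fun i : 'I_r => genW (J i)).
  exists (size B + h)%N => k; have [D D0 [u [sD _ Eu]]] := Hh k.
  exists (B * D); first exact: mulf_neq0.
  split.
    rewrite (leq_trans (size_polyMleq _ _)) // (leq_trans (leq_pred _)) //.
    by rewrite mulnDl leq_add // leq_pmulr.
  exists (fun j => \sum_i u i * v i j).
  apply: ev_imp (ev_and Eu (ev_all Ev)) => x [Eux Evx].
  rewrite hornerM -mulrA Eux mulr_sumr.
  under [RHS]eq_bigr => j _ do rewrite horner_sum mulr_suml.
  rewrite exchange_big; apply: eq_bigr => i _ /=.
  rewrite mulrCA Evx mulr_sumr; apply: eq_bigr => j _.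
  by rewrite hornerM mulrA.
have {few}[h' few] := few.
have [Jw hJw] := sing_diam_exists (mulf_neq0 P0 PR).
have poles := pole_bound M_gt0 R_gt0 P0 PR rec few hJw.
have pl0 : pole_left R P Jw != 0.
  by rewrite prodf_seq_neq0; apply/allP => j _; rewrite shiftp_eq0.
have pr0 := pole_right_neq0 PR Jw.
pose pr := pole_right R P Jw.
have /choice[m hm] (a : 'I_M) : exists m, (0 < m)%N /\ forall c', c' = c %[mod M] ->
    exists u : {poly K}, ev_mod c' (M * m) (fun x => regularized f pr a x = u.[x%:R]).
  have [m m0 hm] := regularized_rational f_mult M_gt0 genJ indJ l_prime e_gt0 Ml q1 fq
    J_lt Jb_lt pl0 pr0 poles Hh a.
  by exists m.
exists (M * \prod_a m a)%N.
  by rewrite muln_gt0 M_gt0 prodn_gt0 // => a; have [] := hm a.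
move=> d; exists pr => //.
(* Here [c * M.-1] stands for -c, so that a = d - c mod M. *)
have aM : ((d + c * M.-1) %% M < M)%N by rewrite ltn_mod.
pose a := Ordinal aM; have [ma0 {}hm] := hm a.
have ea : (a + c)%N = d %[mod M].
  by rewrite modnDml -addnA -mulnSr prednK // addnC modnMDl.
have Mma : (0 < M * m a)%N by rewrite muln_gt0 M_gt0.
(* This is d - a modulo M m_a; the added multiple keeps the natural subtraction exact. *)
pose c' := (M * m a * a + d - a)%N.
have ec' : (c' + a = M * m a * a + d)%N.
  by rewrite subnK // (leq_trans (leq_pmull _ Mma)) // leq_addr.
have [|u [n1 hu]] := hm c'.
  by apply/eqP; rewrite -(eqn_modDr a) ec' -!mulnA [(M * _)%N]mulnC modnMDl addnC ea.
exists (u \Po ('X - (a : nat)%:R%:P)); exists (n1 + a)%N => x lx ex.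
have lax : (a <= x)%N by exact: leq_trans (leq_addl _ _) lx.
rewrite horner_comp hornerXsubC -natrB // -hu ?/regularized ?subnK //.
  by rewrite leq_subRL // addnC.
apply/eqP; rewrite -(eqn_modDr a) subnK // ec' [(M * m a * a)%N]mulnC modnMDl; apply/eqP.
have dv : (M * m a %| M * \prod_a m a)%N.
  by rewrite dvdn_pmul2l // (bigD1 a) //= dvdn_mulr.
by rewrite -(modn_dvdm x dv) ex modn_dvdm.
Qed.

(** * Quasi-rational multiplicative functions *)

Section Multiplicative.
Variables (K : numClosedFieldType) (f : nat -> K).
Hypothesis f_mult : multiplicative_fun f.
Implicit Types (p u : {poly K}).

Definition scalep (y : nat) p := p \Po (y%:R *: 'X).

Lemma scalep_eval y p (x : nat) : (scalep y p).[x%:R] = p.[(y * x)%:R].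
Proof. by rewrite /scalep horner_comp hornerZ hornerX natrM. Qed.

Lemma scalepM y p u : scalep y (p * u) = scalep y p * scalep y u.
Proof. exact: comp_polyM. Qed.

Lemma scalepXn y k : scalep y 'X^k = (y ^ k)%:R *: 'X^k.
Proof. by rewrite /scalep comp_Xn_poly exprZn natrX. Qed.

Lemma lead_coef_scalep y p : (0 < y)%N ->
  lead_coef (scalep y p) = lead_coef p * y%:R ^+ (size p).-1.
Proof.
move=> y0; have ny : y%:R != 0 :> K by rewrite pnatr_eq0 -lt0n.
by rewrite lead_coef_comp ?lead_coefZ ?lead_coefX ?mulr1 // size_scale ?size_polyX.
Qed.

(* If R(y x) is proportional to R(x) = U / P then, after comparing leading
   terms, R(y x) = R(x), so that U is a multiple of P. *)
Lemma scalep_proportional y g (U P : {poly K}) : (1 < y)%N -> U != 0 -> P != 0 ->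
  size U = size P -> scalep y U * P = g%:P * scalep y P * U ->
  exists2 k : K, k != 0 & U = k%:P * P.
Proof.
move=> y1 U0 P0 sUP E; have y0 : (0 < y)%N by exact: ltnW.
have ny : y%:R != 0 :> K by rewrite pnatr_eq0 -lt0n.
have lU : lead_coef U != 0 by rewrite lead_coef_eq0.
have lP : lead_coef P != 0 by rewrite lead_coef_eq0.
have g1 : g = 1.
  have := congr1 lead_coef E; rewrite !lead_coefM lead_coefC !lead_coef_scalep // sUP => e.
  have nz : lead_coef U * y%:R ^+ (size P).-1 * lead_coef P != 0.
    by rewrite !mulf_neq0 // expf_neq0.
  by apply: (mulIf nz); rewrite mul1r {2}e; ring.
pose k := lead_coef U / lead_coef P.
exists k; first by rewrite mulf_neq0 ?invr_eq0.
apply/eqP; rewrite -subr_eq0; apply: contraT; set W := U - _ => W0.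
have EW : scalep y W * P = scalep y P * W.
  rewrite /W /scalep comp_polyB comp_polyM comp_polyC -/(scalep y U) -/(scalep y P).
  by rewrite mulrBl E g1 polyC1; ring.
have sW : (size W < size P)%N.
  have sP : (0 < size P)%N by rewrite size_poly_gt0.
  rewrite -(prednK sP) ltnS; apply/leq_sizeP => j; rewrite leq_eqVlt coefB coefCM.
  move=> /orP[/eqP <-|lj].
    by rewrite -lead_coefE -sUP -lead_coefE /k divfK // subrr.
  by rewrite !nth_default ?mulr0 ?subrr // ?sUP -(prednK sP).
have := congr1 lead_coef EW; rewrite !lead_coefM !lead_coef_scalep // => e.
have lW : lead_coef W != 0 by rewrite lead_coef_eq0.
have : y%:R ^+ (size W).-1 = y%:R ^+ (size P).-1 :> K.
  by apply: (mulIf (mulf_neq0 lW lP)); rewrite [LHS]mulrCA mulrA e; ring.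
rewrite -!natrX => /natf_inj /eqP; rewrite eqn_exp2l //.
have : (0 < size W)%N by rewrite size_poly_gt0.
by move: sW; case: (size W) (size P) => [|a] [|b] //; rewrite ltnS => ab _ /= /eqP e'; rewrite e' ltnn in ab.
Qed.

Variable N : nat.
Hypothesis N_gt0 : (0 < N)%N.

(** The modulus makes the cofactor y both 1 mod N and prime to n. *)
Lemma ev_dilate n n0 : (0 < n)%N -> ev_mod n (n * (N * n)) (fun x =>
  exists y, [/\ x = (n * y)%N, (n0 <= y)%N, y = 1 %[mod N * n] & f x = f n * f y]).
Proof.
move=> npos; exists (n * n0.+1)%N => x lx ex.
have dx : (n %| x)%N.
  have : (n %| x %% (n * (N * n)))%N by rewrite ex -[X in (X %% _)%N]muln1 -muln_modr dvdn_mulr.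
  by rewrite /dvdn modn_dvdm // dvdn_mulr.
have {}[y exy] : exists y, x = (n * y)%N by exists (x %/ n)%N; rewrite mulnC divnK.
rewrite {}exy in lx ex *; rewrite leq_pmul2l // in lx.
have ey : y = 1 %[mod N * n].
  by apply/eqP; rewrite -(eqn_pmul2l npos) !muln_modr ex muln1.
exists y; split=> //; first exact: ltnW.
rewrite f_mult //; first exact: leq_trans lx.
rewrite /coprime -gcdn_modr -(modn_dvdm y (dvdn_mull N (dvdnn n))) ey modn_dvdm ?dvdn_mull //.
by rewrite gcdn_modr gcdn1.
Qed.

Lemma dilate_gt0 n : (0 < n)%N -> (0 < n * (N * n))%N.
Proof. by move=> npos; rewrite !muln_gt0 npos N_gt0. Qed.

Variables (p u : nat -> {poly K}).
Hypothesis p0 : forall d, p d != 0.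
Hypothesis pu : forall d, ev_mod d N (fun x => (p d).[x%:R] * f x = (u d).[x%:R]).

Lemma ev_dilate_sub n d P : (0 < n)%N -> n = d %[mod N] -> ev_mod d N P ->
  ev_mod n (n * (N * n)) P.
Proof. by move=> npos en; apply: ev_sub => //; rewrite mulnCA dvdn_mulr. Qed.

(** Since f is zero at large y = 1 mod N, f (n y) = f n * f y = 0 gives infinitely many zeros of
    [u d] for n = d mod N. *)
Lemma zero_class : u 1%N = 0 -> eventually_zero f.
Proof.
move=> u1; have f1 : ev_mod 1 N (fun y => f y = 0).
  apply: ev_imp (ev_and (pu 1) (poly_ev_neq0 1 N (p0 1))) => x [e px].
  by move: e; rewrite u1 hornerE => /eqP; rewrite mulf_eq0 (negbTE px) => /eqP.
have [n0 {}f1] := f1.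
have u0 d : u d = 0.
  pose n := (N + d)%N; have npos : (0 < n)%N by rewrite addn_gt0 N_gt0.
  have en : n = d %[mod N] by rewrite modnDl.
  apply: (@poly_ev0 _ n _ _ (dilate_gt0 npos)).
  apply: ev_imp (ev_and (ev_dilate n0 npos) (ev_dilate_sub npos en (pu d))).
  move=> x [[y [_ ly ey ->]] <-]; rewrite (f1 y) ?mulr0 //.
  by rewrite -(modn_dvdm y (dvdn_mulr n (dvdnn N))) ey modn_dvdm ?dvdn_mulr.
have {}f0 (d : 'I_N) : ev_mod d N (fun x => f x = 0).
  apply: ev_imp (ev_and (pu d) (poly_ev_neq0 d N (p0 d))) => x [e px].
  by move: e; rewrite u0 hornerE => /eqP; rewrite mulf_eq0 (negbTE px) => /eqP.
have /choice[m hm] := f0; exists (\max_d m d) => x lx.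
have xN : (x %% N < N)%N by rewrite ltn_mod.
apply: (hm (Ordinal xN)); last by rewrite /= modn_mod.
by apply: leq_trans (ltnW lx); exact: leq_bigmax.
Qed.

Lemma monomial_class : u 1%N != 0 -> exists k : int, exists2 kap : K, kap != 0 &
  ev_mod 1 N (fun x => f x = kap * x%:R ^ k).
Proof.
move=> u1; have [n0 hn] := ev_and (pu 1) (poly_ev_neq0 1 N (p0 1)).
pose y := ((n0 + 1) * N + 1)%N.
have ey : y = 1 %[mod N] by rewrite modnMDl.
have y1 : (1 < y)%N by rewrite /y; nia.
have ypos : (0 < y)%N by exact: ltnW.
have E : scalep y (u 1) * p 1 = (f y)%:P * scalep y (p 1) * u 1.
  apply/eqP; rewrite -subr_eq0; apply/eqP.
  have E0 : ev_mod 1 (N * y) (fun x => (scalep y (u 1) * p 1 - (f y)%:P * scalep y (p 1) * u 1).[x%:R] = 0).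
    have [n1 h1] := ev_and (ev_dilate n0 ypos) (ev_dilate_sub ypos ey (pu 1)).
    exists (n0 + n1)%N => x lx ex.
    have [| |[x' [/eqP exx' lx' _ fx] pux]] := h1 (y * x)%N.
    - by rewrite (leq_trans _ (leq_pmull _ ypos)) // (leq_trans _ lx) // leq_addl.
    - by rewrite -muln_modr ex muln_modr muln1.
    rewrite eqn_pmul2l // in exx'; rewrite -(eqP exx') in fx.
    have ex1 : x = 1 %[mod N].
      by rewrite -(modn_dvdm x (dvdn_mulr y (dvdnn N))) ex modn_dvdm ?dvdn_mulr.
    have [px _] := hn x (leq_trans (leq_addr _ _) lx) ex1.
    by rewrite hornerD hornerN !hornerM hornerC !scalep_eval -pux fx -px; ring.
  by apply: poly_ev0 E0; rewrite muln_gt0 N_gt0.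
have EX a b : scalep y ('X^a * u 1) * ('X^b * p 1) =
    ((y ^ a)%:R * f y / (y ^ b)%:R)%:P * scalep y ('X^b * p 1) * ('X^a * u 1).
  have nb : (y ^ b)%:R != 0 :> K by rewrite pnatr_eq0 expn_eq0; lia.
  rewrite !scalepM !scalepXn -!mul_polyC !polyCM.
  transitivity ((y ^ a)%:R%:P * 'X^a * 'X^b * (scalep y (u 1) * p 1)); first by ring.
  rewrite E; transitivity ((y ^ a)%:R%:P * 'X^a * 'X^b * ((f y)%:P * scalep y (p 1) * u 1) *
     ((y ^ b)%:R%:P * (y ^ b)%:R^-1%:P)); last by ring.
  by rewrite -polyCM divff // mulr1.
have sX a (P : {poly K}) : P != 0 -> size ('X^a * P) = (a + size P)%N.
  by move=> P0'; rewrite size_monicM ?monicXn // size_polyXn.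
have nX a (P : {poly K}) : P != 0 -> 'X^a * P != 0.
  by move=> P0'; rewrite mulf_neq0 // monic_neq0 ?monicXn.
(* These truncated differences equalise the degrees of X^a u and X^b p, as [scalep_proportional]
   demands; the exponent is then b - a. *)
pose a := (size (p 1) - size (u 1))%N; pose b := (size (u 1) - size (p 1))%N.
have [|kap kap0 ek] := scalep_proportional y1 (nX a _ u1) (nX b _ (p0 1)) _ (EX a b).
  by rewrite !sX // /a /b; lia.
exists (b%:Z - a%:Z), kap => //; exists n0.+1 => x lx ex.
have [px pnz] := hn x (ltnW lx) ex.
have x0 : x%:R != 0 :> K by rewrite pnatr_eq0; lia.
apply: (mulfI pnz); rewrite px expfzDr // -invr_expz.
have := congr1 (fun P : {poly K} => P.[x%:R]) ek.
rewrite !hornerM hornerC !hornerXn => e.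
apply: (mulfI (expf_neq0 a x0)); rewrite e -!exprnP.
by field; rewrite expf_neq0.
Qed.

End Multiplicative.

Lemma quasi_rational_multiplicative (K : numClosedFieldType) (f : nat -> K) :
  multiplicative_fun f -> quasi_rational f ->
  (exists (k : int) (chi : nat -> K),
     [/\ periodic_fun chi, multiplicative_fun chi
       & forall n : nat, (0 < n)%N -> f n = n%:R ^ k * chi n])
  \/ eventually_zero f.
Proof.
move=> f_mult [N N_gt0 hN].
have /choice[pu hpu] d : exists pu : {poly K} * {poly K}, pu.1 != 0 /\
    ev_mod d N (fun x => pu.1.[x%:R] * f x = pu.2.[x%:R]).
  by have [p p0 [u E]] := hN d; exists (p, u).
pose p d := (pu d).1; pose u d := (pu d).2.
have p0 d : p d != 0 by have [] := hpu d.
have E d : ev_mod d N (fun x => (p d).[x%:R] * f x = (u d).[x%:R]) by have [] := hpu d.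
have [u1|u1] := eqVneq (u 1%N) 0; [right | left].
  exact: (zero_class f_mult N_gt0 p0 E u1).
have [k [kap kap0 [n0 hk]]] := monomial_class f_mult N_gt0 p0 E u1.
have nz n : (0 < n)%N -> n%:R != 0 :> K by rewrite pnatr_eq0 -lt0n.
exists k, (fun n => f n / n%:R ^ k).
have fE n : (0 < n)%N -> f n = n%:R ^ k * (f n / n%:R ^ k).
  by move=> n0'; rewrite mulrC divfK // expfz_neq0 // nz.
split=> //; last first.
  move=> m n m0 n0' co; rewrite f_mult // natrM expfzMl invfM; ring.
exists N => // n npos; pose d := n.
(* Writing x^k as A / B treats both signs of k as polynomial identities. *)
have [A [B [A0 B0 AB]]] : exists A B : {poly K}, [/\ A != 0, B != 0 &
    forall x : nat, (0 < x)%N -> A.[x%:R] = x%:R ^ k * B.[x%:R]].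
  case: k {hk fE} => k.
    exists 'X^k, 1; split; rewrite ?oner_neq0 ?monic_neq0 ?monicXn // => x _.
    by rewrite hornerXn hornerE mulr1.
  exists 1, 'X^(k.+1); split; rewrite ?oner_neq0 ?monic_neq0 ?monicXn // => x /nz x0.
  by rewrite hornerXn hornerE NegzE -exprnN mulVf // expf_neq0.
(* At x = m y with y = 1 mod N, f x / x^k is kap times f m / m^k. The right-hand side depends on m
   only through its class d. *)
have key m : (0 < m)%N -> m = d %[mod N] ->
    (kap * (f m / m%:R ^ k))%:P * A * p d = B * u d.
  move=> mpos em; apply/eqP; rewrite -subr_eq0; apply/eqP.
  apply: (@poly_ev0 _ m _ _ (dilate_gt0 N_gt0 mpos)).
  have := ev_and (ev_dilate f_mult N n0.+1 mpos) (ev_dilate_sub mpos em (E d)).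
  apply: ev_imp => x [[y [exy ly ey fx]] e].
  rewrite hornerD hornerN !hornerM hornerC -e fx (hk y (ltnW ly)); last first.
    by rewrite -(modn_dvdm y (dvdn_mulr m (dvdnn N))) ey modn_dvdm ?dvdn_mulr.
  rewrite AB; last by rewrite exy muln_gt0 mpos (leq_trans _ ly).
  rewrite [X in _ - X](_ : _ = B.[x%:R] * ((p d).[x%:R] * (m%:R ^ k * (f m / m%:R ^ k) * (kap * y%:R ^ k)))).
    by rewrite exy natrM expfzMl; ring.
  by rewrite -fE.
have := key _ npos erefl; rewrite -(key (n + N)%N) ?addn_gt0 ?npos ?modnDr //.
move=> /(mulIf (p0 d)) /(mulIf A0) /polyC_inj /(mulfI kap0) -> //.
Qed.

Theorem theorem1p6 (R : realType) (f : nat -> R[i])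
    (f_mult : multiplicative_fun f)
    (F_Dfinite : D_finite (gen_series f)) :
  (exists (k : int) (chi : nat -> R[i]),
     [/\ periodic_fun chi, multiplicative_fun chi
       & forall n : nat, (0 < n)%N -> f n = (n%:R : R[i]) ^ k * chi n])
  \/ eventually_zero f.
Proof.
have [f0|nz] := EM (eventually_zero f); first by right.
have [m [P [n0 [P0 PR rec]]]] := D_finite_recurrence F_Dfinite.
apply: quasi_rational_multiplicative => //.
exact: (recurrence_quasi_rational f_mult P0 PR rec nz).
Qed.
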